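(* Let $(m_n)_{n\in\mathbb{N}}$ be a sequence in $(0,\infty)$. For each $n\in\mathbb{N}$, let $(X_k^{(n)})_{k\in\mathbb{Z}_+}$ be a Galton--Watson process with inhomogeneous immigration, with offspring variables $\{\xi_{k,j}^{(n)}:k,j\in\mathbb{N}\}$ and immigration process $(Y_k^{(n)})_{k\in\mathbb{Z}_+}$, as defined in the context. Assume the following. (1) $\mathbb{E}(\xi_{1,1}^{(n)})<\infty$ for all $n\in\mathbb{N}$. (2) $\mathbb{E}(Y_k^{(n)})<\infty$ for all $k\in\mathbb{Z}_+$, $n\in\mathbb{N}$, and there exists $L\in D(\mathbb{R}_+,\mathbb{R})$ such that $\limsup_{n\to\infty}\sup_{s\in[0,t]}\mathbb{E}\big(m_n^{-1}Y^{(n)}_{\lfloor ns\rfloor}\big)\le L(t)$ for all $t\in\mathbb{R}_+$. (3) There exists an $\mathbb{R}_+$-valued stochastic process $(\mathcal{Y}_t)_{t\in\mathbb{R}_+}$ with continuous sample paths and $\mathcal{Y}_0=0$ such that $\big(m_n^{-1}Y^{(n)}_{\lfloor nt\rfloor}\big)_{t\in\mathbb{R}_+}\stackrel{\mathcal{D}}{\longrightarrow}(\mathcal{Y}_t)_{t\in\mathbb{R}_+}$ as $n\to\infty$. (4) $\mathbb{E}\big((\xi_{1,1}^{(n)})^2\big)<\infty$ for all $n\in\mathbb{N}$, and $m_n^{-1}\,n\operatorname{Var}(\xi_{1,1}^{(n)})\to 0$ as $n\to\infty$. (5) There exists $a\in[0,1)$ such that $\mathbb{E}(\xi_{1,1}^{(n)})\to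 a$ as $n\to\infty$. Then $$\left(m_n^{-1}\begin{bmatrix}Y^{(n)}_{\lfloor nt\rfloor}\\ X^{(n)}_{\lfloor nt\rfloor}\end{bmatrix}\right)_{t\in\mathbb{R}_+}\stackrel{\mathcal{D}}{\longrightarrow}\left(\begin{bmatrix}\mathcal{Y}_t\\ \frac{1}{1-a}\mathcal{Y}_t\end{bmatrix}\right)_{t\in\mathbb{R}_+}\qquad\text{as } n\to\infty.$$
   Context: $\mathbb{Z}_+$, $\mathbb{N}$, $\mathbb{R}_+$ denote the non-negative integers, the positive integers and the non-negative reals. A Galton--Watson process with inhomogeneous immigration: for each $n\in\mathbb{N}$, $(Y_k^{(n)})_{k\in\mathbb{Z}_+}$ is an arbitrary $\mathbb{Z}_+$-valued stochastic process (its members may be dependent and have different distributions), $\{\xi^{(n)}_{k,j}:k,j\in\mathbb{N}\}$ are independent, identically distributed $\mathbb{Z}_+$-valued random variables independent of $\{Y^{(n)}_k:k\in\mathbb{Z}_+\}$, and $X_0^{(n)}=0$, $X_k^{(n)}=\sum_{j=1}^{X^{(n)}_{k-1}}\xi^{(n)}_{k,j}+Y^{(n)}_{k-1}$ for $k\in\mathbb{N}$, with $\sum_{j=1}^0:=0$. All random variables are defined on a fixed probability space. $D(\mathbb{R}_+,\mathbb{R}^d)$ is the space of càdlàg functions (right continuous with left limits) $\mathbb{R}_+\to\mathbb{R}^d$, endowed with the Skorokhod $J_1$ topology (a separable, completely metrizable topology) and its Borel $\sigma$-algebra. Here $f_n\to f$ in $J_1$ iff there are continuous strictly increasing $\lambda_n:\mathbb{R}_+\to\mathbb{R}_+$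 with $\lambda_n(0)=0$, $\lim_{t\to\infty}\lambda_n(t)=\infty$, $\sup_{t\in\mathbb{R}_+}|\lambda_n(t)-t|\to0$ and $\sup_{t\in[0,K]}\|f_n(\lambda_n(t))-f(t)\|\to0$ for all $K>0$. For càdlàg processes, $\stackrel{\mathcal{D}}{\longrightarrow}$ denotes weak convergence of their distributions on $D(\mathbb{R}_+,\mathbb{R}^d)$ (with $d=2$ in the conclusion). *)

(* Defs.v *)
From HB Require Import structures.
From mathcomp Require Import all_boot all_order all_algebra finmap.
From mathcomp Require Import all_classical all_reals all_analysis.

Set Implicit Arguments.
Unset Strict Implicit.
Unset Printing Implicit Defensive.

Import Order.TTheory GRing.Theory Num.Theory.
Import numFieldNormedType.Exports.

Local Open Scope classical_set_scope.
Local Open Scope ring_scope.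

(* Used as a type through the coercion of sets to types, with the topology
   induced by that of `R`. *)
Definition Rplus (R : realType) : set R := [set t | 0 <= t].
Arguments Rplus : clear implicits.

(* At `t = 0` the filter of left neighbourhoods contains every set, so that
   no left limit is required there. *)
Definition cadlag (R : realType) (V : normedModType R) (f : Rplus R -> V) :=
  forall t : Rplus R,
    (f @ within [set s | set_val t < set_val s] (nbhs t) --> f t) /\
    cvg (f @ within [set s | set_val s < set_val t] (nbhs t)).

Record skorokhod (R : realType) (V : normedModType R) := Skorokhod {
  skorokhod_fun :> Rplus R -> V ;
  skorokhodP : cadlag skorokhod_fun }.

Section cadlag_paths.
Context {R : realType} {V : normedModType R}.

Lemma continuous_cadlag (f : Rplus R -> V) : continuous f -> cadlag f.
Proof.
move=> cf t; split; first exact: cvg_within_filter (cf t).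
by apply/cvg_ex; exists (f t); exact: cvg_within_filter (cf t).
Qed.

Lemma continuous_val : continuous (set_val : Rplus R -> R).
Proof. exact: initial_continuous. Qed.

Lemma near_val_lt (t : Rplus R) (b : R) : set_val t < b ->
  \forall s \near t, set_val s < b.
Proof. by move=> tb; exact: cvgr_lt (@continuous_val t) _ tb. Qed.

Lemma near_val_gt (t : Rplus R) (b : R) : b < set_val t ->
  \forall s \near t, b < set_val s.
Proof. by move=> tb; exact: cvgr_gt (@continuous_val t) _ tb. Qed.

(* t |-> u_(floor (n t)); `Num.truncn` is the floor on nonnegative reals. *)
Definition step_fun (n : nat) (u : nat -> V) (t : Rplus R) : V :=
  u (Num.truncn (n%:R * set_val t)).

Lemma step_fun_cadlag n u : cadlag (step_fun n u).
Proof.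
have ge0 (t : Rplus R) : 0 <= set_val t by have := set_valP t.
have nge0 (t : Rplus R) : 0 <= n%:R * set_val t by rewrite mulr_ge0.
move=> t; have /andP[kt tk] := truncn_itv (nge0 t).
set k := Num.truncn _ in kt tk.
have [->|n0] := posnP n.
  suff -> : step_fun 0 u = cst (u 0%N).
    by split; [exact: cvg_cst|exact: is_cvg_cst].
  by apply/funext => s; rewrite /step_fun mul0r truncn0.
have nR0 : 0 < n%:R :> R by rewrite ltr0n.
split.
  apply: cvg_near_cst.
  have : \forall s \near t, set_val s < k.+1%:R / n%:R.
    by apply: near_val_lt; rewrite ltr_pdivlMr// mulrC.
  apply: filterS => s sk /= ts; rewrite /step_fun -/k.
  congr u; apply: truncn_def.
  rewrite mulrC -ltr_pdivlMr// sk andbT (le_trans kt)//.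
  by rewrite mulrC ler_pM2l// ltW.
pose k' := if n%:R * set_val t == k%:R then k.-1 else k.
apply/cvg_ex; exists (u k'); apply: cvg_near_cst.
have near_or (b : bool) (c : R) : (~~ b -> c < set_val t) ->
    nbhs t [set s : Rplus R | b || (c < set_val s)].
  case: b => [_|/(_ isT) ct]; first exact: filterE.
  exact: (@near_val_gt t c ct).
have near1 := near_or (n%:R * set_val t == k%:R) (k%:R / n%:R).
have near2 := near_or (k == 0)%N (k.-1%:R / n%:R).
apply: filterS2 (near2 _) (near1 _) => [s s1 s2 /= st|k0|ne]; last 2 first.
- rewrite ltr_pdivrMr// mulrC (lt_le_trans _ kt)//.
  by rewrite ltr_nat prednK// lt0n.
- by rewrite ltr_pdivrMr// mulrC lt_neqAle kt andbT eq_sym.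
rewrite /step_fun; congr u.
have st' : n%:R * set_val s < n%:R * set_val t by rewrite ltr_pM2l.
rewrite /k'; case: eqVneq s2 => /= [e _|ne s2]; last first.
  apply: truncn_def; rewrite (lt_trans st' tk) andbT mulrC -ler_pdivrMr//.
  exact: ltW.
case: (posnP k) s1 e st' => [->|k0] /= s1 e st'.
  by move: st'; rewrite e ltNge nge0.
apply: truncn_def; rewrite prednK// -e st' andbT mulrC -ler_pdivrMr//.
exact: ltW.
Qed.

Definition step_path (n : nat) (u : nat -> V) : skorokhod V :=
  Skorokhod (@step_fun_cadlag n u).

Definition continuous_path (f : Rplus R -> V) (cf : continuous f) :
  skorokhod V := Skorokhod (continuous_cadlag cf).

End cadlag_paths.

Section col2.
Context {R : realType}.

Definition col2 (x y : R) : 'cV[R]_2 := \col_i (if i == 0 then x else y).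

Lemma cvg_col2 (I : Type) (F : set_system I) (FF : Filter F) (f g : I -> R)
    (x y : R) : f @ F --> x -> g @ F --> y ->
  (fun t => col2 (f t) (g t)) @ F --> col2 x y.
Proof.
have col2E u v : col2 u v = u *: col2 1 0 + v *: col2 0 1.
  apply/matrixP => i j; rewrite !mxE.
  by case: ifP => _; rewrite mulr0 mulr1 ?addr0 ?add0r.
rewrite col2E (_ : (fun t => col2 _ _) =
    (fun t => f t *: col2 1 0 + g t *: col2 0 1)); last first.
  by apply/funext => t; exact: col2E.
by move=> fx gy; apply: cvgD; exact: cvgZr_tmp.
Qed.

Lemma continuous_col2 (f g : Rplus R -> R) :
  continuous f -> continuous g -> continuous (fun t => col2 (f t) (g t)).
Proof. by move=> cf cg t; exact: cvg_col2 (cf t) (cg t). Qed.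

Lemma continuous_cmul (c : R) (f : Rplus R -> R) :
  continuous f -> continuous (fun t => c * f t).
Proof. by move=> cf t; exact: cvgMl_tmp (cf t). Qed.

End col2.

Section J1.
Context {R : realType} {V : normedModType R}.
Implicit Types (f : skorokhod V) (U : set (skorokhod V)).

Definition time_change (lam : Rplus R -> Rplus R) :=
  [/\ continuous lam,
      (forall s t, set_val s < set_val t ->
        set_val (lam s) < set_val (lam t)),
      (forall t, set_val t = 0 -> set_val (lam t) = 0) &
      (forall M : R, exists K : R, forall t,
        K <= set_val t -> M <= set_val (lam t))].

Definition J1_cvg (f_ : nat -> skorokhod V) f :=
  exists lam : nat -> Rplus R -> Rplus R,
    [/\ (forall n, time_change (lam n)),
        ereal_sup [set `|set_val (lam n t) - set_val t|%:E
          | t in [set: Rplus R]] @[n --> \oo] --> 0%E &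
        forall K : R, 0 < K ->
          ereal_sup [set `|f_ n (lam n t) - f t|%:E
            | t in [set t : Rplus R | set_val t <= K]] @[n --> \oo] --> 0%E].

(* The J1 topology is metrizable, hence sequential: it is determined by its
   convergent sequences, and its open sets are the sequentially open ones. *)
Definition J1_open U :=
  forall (f_ : nat -> skorokhod V) f, J1_cvg f_ f -> U f ->
    \forall n \near \oo, U (f_ n).

Lemma J1_openT : J1_open setT.
Proof. by move=> f_ f _ _; exact: nearW. Qed.

Lemma J1_openI : setI_closed J1_open.
Proof.
move=> U W oU oW f_ f cf [Uf Wf].
by apply: filterS2 (oU _ _ cf Uf) (oW _ _ cf Wf).
Qed.

Lemma J1_open_bigU (I : Type) (U_ : I -> set (skorokhod V)) :
  (forall i, J1_open (U_ i)) -> J1_open (\bigcup_i U_ i).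
Proof.
move=> oU f_ f cf [i _ Uif].
by apply: filterS (oU i _ _ cf Uif) => n Un; exists i.
Qed.

HB.instance Definition _ := gen_eqMixin (skorokhod V).
HB.instance Definition _ := gen_choiceMixin (skorokhod V).
HB.instance Definition _ := isPointed.Build (skorokhod V)
  (step_path 0 (fun=> 0)).
HB.instance Definition _ := isOpenTopological.Build (skorokhod V)
  J1_openT J1_openI J1_open_bigU.

Lemma J1_openE : @open (skorokhod V) = J1_open.
Proof. by []. Qed.

End J1.

Notation borel E := (g_sigma_algebraType (@open E)).

(* `mu_ n` and `mu` are meant to be probability measures. *)
Definition weak_cvg (R : realType) (E : ptopologicalType)
    (mu_ : nat -> set (borel E) -> \bar R) (mu : set (borel E) -> \bar R) :=
  forall h : E -> R, continuous h -> (exists M : R, forall x, `|h x| <= M) ->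
    (\int[mu_ n]_x (h x)%:E)%E @[n --> \oo] --> (\int[mu]_x (h x)%:E)%E.

(* The distribution of `Z` is its image measure on the Borel sets of the J1
   topology. `Z` has to be measurable for them, which is the case as soon as
   the `fun w => Z w t` are random variables and `V` is finite-dimensional. *)
Definition cvg_in_distribution d (T : measurableType d) (R : realType)
    (P : probability T R) (V : normedModType R)
    (Z_ : nat -> T -> skorokhod V) (Z : T -> skorokhod V) :=
  weak_cvg (fun n => pushforward P (Z_ n : T -> borel (skorokhod V)))
           (pushforward P (Z : T -> borel (skorokhod V))).

Section independence.
Context d d' (T : measurableType d) (T' : measurableType d') (R : realType).
Variable P : probability T R.
Local Open Scope ereal_scope.

Definition mutually_independent (I : choiceType) (D : set I)
    (X : I -> {RV P >-> T'}) :=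
  forall (J : {fset I}) (B : I -> set T'),
    [set` J] `<=` D -> (forall i, measurable (B i)) ->
    P (\bigcap_(i in [set` J]) (X i @^-1` B i)) =
    \prod_(i <- J) P (X i @^-1` B i).

Definition identically_distributed (X X' : {RV P >-> T'}) :=
  forall B, measurable B -> distribution P X B = distribution P X' B.

Definition sigma_generated (I : Type) (D : set I) (X : I -> {RV P >-> T'}) :=
  <<s \bigcup_(i in D) preimage_set_system setT (X i) measurable >>.

Definition independent_families (I I' : Type) (D : set I) (D' : set I')
    (X : I -> {RV P >-> T'}) (X' : I' -> {RV P >-> T'}) :=
  forall A A', sigma_generated D X A -> sigma_generated D' X' A' ->
    P (A `&` A') = P A * P A'.

End independence.

(* The offspring variables are the `xi k j` with `0 < k` and `0 < j`. *)
Definition GW_immigration d (T : measurableType d) (R : realType)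
    (P : probability T R) (xi : nat -> nat -> {RV P >-> nat})
    (Y : nat -> {RV P >-> nat}) (X : nat -> T -> nat) :=
  let pos := [set kj : nat * nat | (0 < kj.1)%N /\ (0 < kj.2)%N] in
  let xi' (kj : nat * nat) := xi kj.1 kj.2 in
  [/\ mutually_independent pos xi',
      (forall kj, pos kj -> identically_distributed (xi' kj) (xi 1%N 1%N)),
      independent_families pos setT xi' Y,
      (forall w, X 0%N w = 0%N) &
      (forall k w, X k.+1 w =
        (\sum_(1 <= j < (X k w).+1) xi k.+1 j w + Y k w)%N)].

(* Main.v *)
Require Import Defs.
From HB Require Import structures.
From mathcomp Require Import all_boot all_order all_algebra finmap.
From mathcomp Require Import all_classical all_reals all_analysis.
From mathcomp Require Import measurable_realfun ring lra.

(** Solving the recursion, [X_i / m_n] is the autoregression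
    [S_(i+1) = a_n S_i + Y_i / m_n + e_i], where [a_n] is the offspring mean and
    [e_i] the rescaled martingale difference. Summing the variances of the
    [e_i] and using Chebyshev's inequality, all of them up to time [n K] are
    uniformly small with high probability. When the path of [Y / m_n] is close
    to a continuous path vanishing at [0], the autoregression stays close to
    [1 / (1 - a)] times that path.

    No Skorokhod representation is used: for a continuous bounded [h], let [B_k]
    be the set of paths [f] for which [h] at the perturbed pair (path,
    autoregression) differs by more than [eps] from [h] at [(f, f / (1 - a))]
    for some [n >= k] and some noise of size at most [1 / (k + 1)]. A continuous
    path vanishing at [0] is at positive distance from [B_k] for large [k], so
    that a Lipschitz cutoff equal to [1] on [B_k] is a J1-continuous test
    function whose integral against the limit law tends to [0]. The distance
    only has to detect uniform convergence towards continuous paths; it compares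
    suprema of Lipschitz functions over graphs. *)

Set Implicit Arguments.
Unset Strict Implicit.
Unset Printing Implicit Defensive.

Import Order.TTheory GRing.Theory Num.Theory.
Import numFieldNormedType.Exports.

Local Open Scope classical_set_scope.
Local Open Scope ring_scope.

(** * Convergence in the J1 topology *)

Lemma cvge0P (R : realType) (u : nat -> \bar R) : (forall n, 0 <= u n)%E ->
  u @ \oo --> 0%E <->
  forall e : R, 0 < e -> \forall n \near \oo, (u n <= e%:E)%E.
Proof.
move=> u0; split=> [cu e e0|eu].
  have n0 : nbhs 0%:E [set y | (y < (0 + e)%:E)%E].
    by apply: (@nbhs_open_ereal_lt R 0 (fun r => r + e)); rewrite ltrDl.
  have : \forall n \near \oo, (u n < (0 + e)%:E)%E by exact: cu n0.
  by apply: filterS => n /ltW; rewrite add0r.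
apply/fine_cvgP; split.
  apply: filterS (eu 1 ltr01) => n un.
  by rewrite ge0_fin_numE// (le_lt_trans un)// ltry.
apply/cvgrPdist_le => /= e e0; apply: filterS (eu e e0) => n un.
rewrite sub0r normrN ger0_norm ?fine_ge0//.
by rewrite -lee_fin fineK// ge0_fin_numE// (le_lt_trans un)// ltry.
Qed.

Lemma cvg_ereal_sup0P (R : realType) (I : Type) (D : set I)
    (F : nat -> I -> R) : D !=set0 -> (forall n i, 0 <= F n i) ->
  ereal_sup [set (F n i)%:E | i in D] @[n --> \oo] --> 0%E <->
  forall e : R, 0 < e -> \forall n \near \oo, forall i, D i -> F n i <= e.
Proof.
move=> [i0 Di0] F0.
have sup0 n : (0 <= ereal_sup [set (F n i)%:E | i in D])%E.
  by apply: le_ereal_sup_tmp; exists (F n i0)%:E; [exists i0|rewrite lee_fin].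
rewrite cvge0P//; split=> h e e0; apply: filterS (h e e0) => n.
  move=> /ereal_supP Fe i Di; rewrite -lee_fin; apply: Fe.
  by exists i.
by move=> Fe; apply/ereal_supP => _ [i Di <-]; rewrite lee_fin Fe.
Qed.

(** Compactness is used in its near-covering form, with radii tending to [0] from the right. Only
    [x] has to lie in [A]: [y] may leave it, as happens at the end of a time interval. *)
Lemma continuous_uniform_compact (R : realType) (V : normedModType R)
    (f : R -> V) (A : set R) (e : R) : continuous f -> compact A -> 0 < e ->
  exists2 r, 0 < r & forall x y, A x -> `|x - y| <= r -> `|f x - f y| <= e.
Proof.
move=> cf /compact_near_coveringP/(_ _ (0:R)^'+
  (fun r x => forall y, `|x - y| <= r -> `|f x - f y| <= e)) cA e0.
have /cA : forall x, A x -> \forall x' \near x & r \near (0:R)^'+,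
    forall y, `|x' - y| <= r -> `|f x' - f y| <= e.
  move=> x _.
  have /cvgrPdist_le/(_ (e / 2)) := cf x; rewrite divr_gt0// => /(_ isT).
  move=> /nbhs_normP[r /= r0 xr].
  near=> x' r' => y x'y.
  have x'r : `|x - x'| < r / 2.
    by near: x'; apply: (@cvgr_dist_lt _ _ _ (nbhs x) _ id x) => //; rewrite divr_gt0.
  have r'r : r' < r / 2 by near: r'; apply: nbhs_right_lt; rewrite divr_gt0.
  rewrite (splitr e) (le_trans (ler_distD (f x) _ _))// lerD//.
    by rewrite distrC; apply: xr => /=; rewrite (lt_trans x'r)//; lra.
  apply: xr => /=; rewrite (le_lt_trans (ler_distD x' _ _))//.
  by rewrite (splitr r) ltrD// (le_lt_trans x'y).
move=> /= cA'; near (0:R)^'+ => r.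
exists r; first by near: r; exact: nbhs_right_gt.
move=> x y Ax; have : A `<=` [set x | forall y, `|x - y| <= r -> `|f x - f y| <= e].
  by near: r; exact: cA'.
by move=> /(_ _ Ax); exact.
Unshelve. all: by end_near. Qed.

Section Rplus.
Context {R : realType}.
Implicit Types t : Rplus R.

Fact max0_ge0 (x : R) : Rplus R (Num.max 0 x).
Proof. by rewrite /Rplus /= le_max lexx. Qed.

Definition to_Rplus (x : R) : Rplus R := SigSub (mem_set (max0_ge0 x)).

Lemma Rplus_ge0 t : 0 <= set_val t.
Proof. exact: (set_valP t). Qed.

Lemma to_RplusE (x : R) : set_val (to_Rplus x) = Num.max 0 x.
Proof. by rewrite set_valE. Qed.

Lemma to_RplusK (x : R) : 0 <= x -> set_val (to_Rplus x) = x.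
Proof. by move=> x0; rewrite to_RplusE max_r. Qed.

Lemma set_valK_Rplus t : to_Rplus (set_val t) = t.
Proof. by apply: val_inj; exact: to_RplusK (Rplus_ge0 t). Qed.

Lemma continuous_to_Rplus : continuous to_Rplus.
Proof.
apply: continuous_comp_initial => x.
apply: (@continuous_max _ _ (cst 0) id); first exact: cst_continuous.
exact: cvg_id.
Qed.

(** Read on the whole line through [to_Rplus], [lam] vanishes at [0] and exceeds any given value, so
    the intermediate value theorem applies. *)
Lemma time_change_surj (lam : Rplus R -> Rplus R) : time_change lam ->
  forall s, exists t, lam t = s.
Proof.
move=> [clam _ lam0 laminf] s.
have [K hK] := laminf (set_val s).
pose F x := set_val (lam (to_Rplus x)).
have cF : continuous F.
  move=> x; apply: (@continuous_comp _ _ _ (lam \o to_Rplus) set_val).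
    by apply: continuous_comp; [exact: continuous_to_Rplus|exact: clam].
  exact: continuous_val.
have K0 : 0 <= Num.max 0 K by rewrite le_max lexx.
have F0 : F 0 = 0 by apply: lam0; rewrite to_RplusK.
have FK : set_val s <= F (Num.max 0 K).
  by apply: hK; rewrite to_RplusK// le_max lexx orbT.
have : Num.min (F 0) (F (Num.max 0 K)) <= set_val s <=
       Num.max (F 0) (F (Num.max 0 K)).
  by rewrite F0 ge_min le_max FK orbT Rplus_ge0.
move=> /(IVT K0 (continuous_subspaceT cF))[x _ Fx].
exists (to_Rplus x); apply: val_inj; exact: Fx.
Qed.

End Rplus.

Section J1_sequences.
Context {R : realType} {V : normedModType R}.
Implicit Types (f g : skorokhod V).

Lemma J1_cvgP (f_ : nat -> skorokhod V) f : J1_cvg f_ f <->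
  exists2 lam : nat -> Rplus R -> Rplus R, (forall n, time_change (lam n)) &
    forall e K : R, 0 < e -> 0 < K -> \forall n \near \oo,
      (forall t, `|set_val (lam n t) - set_val t| <= e) /\
      (forall t, set_val t <= K -> `|f_ n (lam n t) - f t| <= e).
Proof.
have T0 : [set: Rplus R] !=set0 by exists (to_Rplus 0).
have K0 K : 0 < K -> [set t : Rplus R | set_val t <= K] !=set0.
  by move=> K0; exists (to_Rplus 0) => /=; rewrite to_RplusK// ltW.
split=> [[lam [tc]]|[lam tc h]].
  move=> /(cvg_ereal_sup0P T0 (fun _ _ => normr_ge0 _)) lam0 f0.
  exists lam => // e K e0 Kgt0.
  have /(cvg_ereal_sup0P (K0 _ Kgt0) (fun _ _ => normr_ge0 _)) fK := f0 _ Kgt0.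
  apply: filterS2 (lam0 e e0) (fK e e0) => n l1 l2; split => // t.
  exact: l1.
exists lam; split => //.
  apply/cvg_ereal_sup0P => // e e0.
  by apply: filterS (h e 1 e0 ltr01) => n [l _] t _; exact: l.
move=> K Kgt0; apply/cvg_ereal_sup0P => //; first exact: K0.
by move=> e e0; apply: filterS (h e K e0 Kgt0) => n [_ l].
Qed.

Lemma J1_cvg_nbhs (f_ : nat -> skorokhod V) f : J1_cvg f_ f -> f_ @ \oo --> f.
Proof.
move=> ff A; rewrite nbhsE => -[U [oU Uf] UA].
by apply: filterS (oU _ _ ff Uf) => n /UA.
Qed.

(** The open sets are by definition the sequentially open ones, so sequential continuity is
    enough. *)
Lemma J1_continuous (W : topologicalType) (F : skorokhod V -> W) :
  (forall (f_ : nat -> skorokhod V) f, J1_cvg f_ f -> F (f_ n) @[n --> \oo] --> F f) -> continuous F.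
Proof.
move=> h; apply/continuousP => A oA.
change (J1_open (F @^-1` A)) => f_ f ff Af.
by apply: h ff _ _; exact: open_nbhs_nbhs.
Qed.

Lemma continuous_J1 (W : topologicalType) (F : skorokhod V -> W)
    (f_ : nat -> skorokhod V) f :
  continuous F -> J1_cvg f_ f -> F (f_ n) @[n --> \oo] --> F f.
Proof. by move=> cF /J1_cvg_nbhs; apply: continuous_cvg; exact: cF. Qed.

Lemma unif_J1_cvg (f_ : nat -> skorokhod V) f :
  (forall e K : R, 0 < e -> 0 < K -> \forall n \near \oo,
    forall t, set_val t <= K -> `|f_ n t - f t| <= e) -> J1_cvg f_ f.
Proof.
move=> h; apply/J1_cvgP; exists (fun=> id).
  by move=> n; split => //; [move=> t; exact: cvg_id|move=> M; exists M].
move=> e K e0 K0; apply: filterS (h e K e0 K0) => n fn; split => // t.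
by rewrite subrr normr0 ltW.
Qed.

End J1_sequences.

(** * A distance between graphs *)

Section graph_distance.
Context {R : realType} {V : normedModType R}.
Implicit Types (f g : skorokhod V) (phi : R -> V -> R).

(** The decay [(1 + t)^-1] damps late times, because J1 convergence controls values on bounded time
    intervals only. *)
Definition test_fun phi :=
  (forall s t x y, `|phi s x - phi t y| <= `|s - t| + `|x - y|) /\
  (forall t x, 0 <= t -> 0 <= phi t x <= (1 + t)^-1).

Definition graph_sup phi f := sup (range (fun t => phi (set_val t) (f t))).

Lemma test_fun_le1 phi t x : test_fun phi -> 0 <= t -> phi t x <= 1.
Proof.
move=> [_ h] t0; have /andP[_ /le_trans] := h t x t0; apply.
by rewrite invf_le1 ?ltr_pwDl// lerDl.
Qed.

Lemma graph_sup_ge phi f t : test_fun phi -> phi (set_val t) (f t) <= graph_sup phi f.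
Proof.
move=> tphi; apply: ub_le_sup; last by exists t.
by exists 1 => _ [s _ <-]; apply: test_fun_le1 => //; exact: Rplus_ge0.
Qed.

Lemma graph_sup_le phi f (b : R) :
  (forall t, phi (set_val t) (f t) <= b) -> graph_sup phi f <= b.
Proof.
move=> h; apply: ge_sup; last by move=> _ [t _ <-].
by exists (phi (set_val (to_Rplus 0)) (f (to_Rplus 0))), (to_Rplus 0).
Qed.

Lemma graph_sup_itv phi f : test_fun phi -> 0 <= graph_sup phi f <= 1.
Proof.
move=> tphi; apply/andP; split.
  apply: le_trans (@graph_sup_ge _ f (to_Rplus 0) tphi).
  by case: tphi => _ h; have /andP[] := h (set_val (to_Rplus 0)) (f (to_Rplus 0)) (Rplus_ge0 _).
by apply: graph_sup_le => t; exact: test_fun_le1 (Rplus_ge0 _).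
Qed.

Lemma test_fun0 : test_fun (fun _ _ => 0).
Proof.
split=> [s t x y|t x t0]; first by rewrite subrr normr0 addr_ge0.
by rewrite lexx invr_ge0 addr_ge0.
Qed.

(** A pseudometric. A supremum over the graph forgets the parametrization by time, so a time change
    costs no more than its displacement. *)
Definition graph_dist f g :=
  sup [set `|graph_sup phi f - graph_sup phi g| | phi in test_fun].

Lemma graph_dist_ge phi f g : test_fun phi ->
  `|graph_sup phi f - graph_sup phi g| <= graph_dist f g.
Proof.
move=> tphi; apply: ub_le_sup; last by exists phi.
exists 1 => _ [psi tpsi <-].
have := @graph_sup_itv _ f tpsi; have := @graph_sup_itv _ g tpsi.
by move=> /andP[? ?] /andP[? ?]; rewrite ler_norml; apply/andP; split; lra.
Qed.

Lemma graph_dist_le f g (b : R) : (forall phi, test_fun phi ->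
  `|graph_sup phi f - graph_sup phi g| <= b) -> graph_dist f g <= b.
Proof.
move=> h; apply: ge_sup; last by move=> _ [phi tphi <-]; exact: h.
by eexists; exists (fun _ _ => 0) => //; exact: test_fun0.
Qed.

Lemma graph_dist_triangle f g k :
  graph_dist f k <= graph_dist f g + graph_dist g k.
Proof.
apply: graph_dist_le => phi tphi.
rewrite (le_trans (ler_distD (graph_sup phi g) _ _))// lerD//.
  exact: graph_dist_ge.
exact: graph_dist_ge.
Qed.

Lemma graph_distC f g : graph_dist f g = graph_dist g f.
Proof.
by apply/eqP; rewrite eq_le; apply/andP; split; apply: graph_dist_le => phi tphi;
  rewrite distrC; exact: graph_dist_ge.
Qed.

Lemma graph_distxx f : graph_dist f f = 0.
Proof.
apply/eqP; rewrite eq_le; apply/andP; split.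
  by apply: graph_dist_le => phi tphi; rewrite subrr normr0.
by apply: le_trans (@graph_dist_ge _ f f test_fun0).
Qed.

Lemma J1_graph_dist (f_ : nat -> skorokhod V) f : J1_cvg f_ f ->
  graph_dist (f_ n) f @[n --> \oo] --> 0.
Proof.
move=> /J1_cvgP[lam tc h]; apply/cvgrPdist_le => e e0.
pose d := Num.min (e / 2) 1.
have d0 : 0 < d by rewrite lt_min divr_gt0 ?ltr01.
have [d1 de] : d <= 1 /\ d <= e / 2 by rewrite !ge_min !lexx orbT.
(* The [+ 1] leaves room for the time change: as [d <= 1], for [t] beyond [K] both [t] and [lam n t]
   are at least [e^-1], where test functions are at most [e]. *)
pose K := e^-1 + 1.
have K0 : 0 < K by rewrite addr_gt0// invr_gt0.
near=> n.
have [l1 l2] : (forall t, `|set_val (lam n t) - set_val t| <= d) /\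
      (forall t, set_val t <= K -> `|f_ n (lam n t) - f t| <= d).
  by near: n; exact: h.
rewrite sub0r normrN ger0_norm; last first.
  by apply: le_trans (@graph_dist_ge _ (f_ n) f test_fun0).
apply: graph_dist_le => phi tphi.
have key t : `|phi (set_val (lam n t)) (f_ n (lam n t)) -
               phi (set_val t) (f t)| <= e.
  have [tK|Kt] := lerP (set_val t) K.
    case: tphi => tphi _; apply: le_trans (tphi _ _ _ _) _.
    have := l1 t; have := l2 t tK.
    by rewrite (splitr e) => ? ?; apply: lerD; lra.
  have tail s x : K - 1 <= s -> 0 <= s -> 0 <= phi s x <= e.
    move=> Ks s0; case: tphi => _ /(_ s x s0) /andP[-> /le_trans] /=; apply.
    by rewrite -(invrK e) lef_pV2 ?posrE ?invr_gt0//; [rewrite /K in Ks; lra|lra].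
  have := l1 t; rewrite ler_norml => /andP[? ?].
  have /andP[? ?] := tail (set_val t) (f t) ltac:(lra) (Rplus_ge0 _).
  have /andP[? ?] := tail (set_val (lam n t)) (f_ n (lam n t)) ltac:(lra) (Rplus_ge0 _).
  by rewrite ler_norml; apply/andP; split; lra.
rewrite ler_norml; apply/andP; split.
  rewrite lerBrDr addrC -lerBrDr opprK; apply: graph_sup_le => t.
  have := key t; rewrite ler_norml => /andP[? ?].
  have := @graph_sup_ge _ (f_ n) (lam n t) tphi; lra.
rewrite lerBlDr; apply: graph_sup_le => s.
(* Surjectivity of the time change is what lets every point of the graph of [f_ n] be compared with
   a point of the graph of [f]. *)
have [t ts] := time_change_surj (tc n) s; rewrite -ts.
have := key t; rewrite ler_norml => /andP[? ?].
have := @graph_sup_ge _ f t tphi; lra.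
Unshelve. all: by end_near. Qed.

(** Where the cone is positive, [t < t0 + r <= K + 1], so its height [r <= (K + 2)^-1] respects the
    decay bound. *)
Lemma test_fun_cone (t0 K r : R) (x0 : V) : 0 <= t0 <= K -> r <= (K + 2)^-1 ->
  test_fun (fun t x => Num.max 0 (r - `|t - t0| - `|x - x0|)).
Proof.
move=> /andP[t0_ge0 t0K] rK; split=> [s t x y|t x tge0].
  have h1 := ler_dist_dist (s - t0) (t - t0).
  have h2 := ler_dist_dist (x - x0) (y - x0).
  have e1 : s - t0 - (t - t0) = s - t by lra.
  have e2 : x - x0 - (y - x0) = x - y by rewrite opprB addrA subrK.
  move: h1 h2; rewrite e1 e2 !ler_norml => /andP[? ?] /andP[? ?].
  have := normr_ge0 (s - t); have := normr_ge0 (x - y) => ? ?.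
  by apply/andP; split; rewrite !maxEle; case: ifPn; case: ifPn; rewrite -?ltNge => ? ?; lra.
have inv0 : 0 <= (1 + t)^-1 by rewrite invr_ge0; lra.
rewrite le_max lexx ge_max inv0/=.
have [rt|tr] := lerP r `|t - t0|.
  by have := normr_ge0 (x - x0); lra.
apply: (@le_trans _ _ r).
  by have := normr_ge0 (x - x0); have := normr_ge0 (t - t0); lra.
have [K2 t1] : 0 < K + 2 /\ 0 < 1 + t by split; lra.
have K21 : (K + 2)^-1 <= 1 by rewrite invf_le1//; lra.
apply: (le_trans rK); rewrite lef_pV2//.
by have := ler_norm (t - t0); lra.
Qed.

(** The cone of height [q] centred at [(t, g t)] gives [g] a supremum of at least [q]. If [g t] were
    farther than [e] from [f t], uniform continuity would keep the graph of [f] outside that cone,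
    making its supremum [0] and the distance at least [q]. *)
Lemma graph_dist_unif f (K e : R) : continuous f -> 0 <= K -> 0 < e ->
  exists2 r, 0 < r & forall g, graph_dist g f < r ->
    forall t, set_val t <= K -> `|g t - f t| <= e.
Proof.
move=> cf K0 e0.
have cF : continuous (f \o to_Rplus).
  by move=> x; apply: continuous_comp; [exact: continuous_to_Rplus|exact: cf].
have [r r0 fr] := @continuous_uniform_compact _ _ _ `[0, K] (e / 2) cF
  (@segment_compact _ 0 K) (divr_gt0 e0 (ltr0n _ 2)).
pose q := Num.min r (Num.min (e / 2) (K + 2)^-1).
have q0 : 0 < q by rewrite !lt_min r0 divr_gt0// invr_gt0; lra.
have [qr qe qK] : [/\ q <= r, q <= e / 2 & q <= (K + 2)^-1].
  by rewrite !ge_min !lexx !orbT.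
exists q => // g gf t tK; rewrite leNgt; apply/negP => efg.
pose phi (s : R) (x : V) := Num.max 0 (q - `|s - set_val t| - `|x - g t|).
have tphi : test_fun phi by apply: test_fun_cone qK; rewrite Rplus_ge0.
have phig : q <= graph_sup phi g.
  apply: le_trans (@graph_sup_ge _ g t tphi).
  by rewrite /phi !subrr !normr0 !subr0 le_max lexx orbT.
have phif : graph_sup phi f <= 0.
  apply: graph_sup_le => s; rewrite /phi ge_max lexx/=.
  have [qs|sq] := lerP q `|set_val s - set_val t|.
    by have := normr_ge0 (f s - g t); lra.
  have : `|f t - f s| <= e / 2.
    have := fr (set_val t) (set_val s).
    rewrite /= !set_valK_Rplus; apply.
      by rewrite in_itv/= Rplus_ge0.
    by rewrite distrC; lra.
  have := ler_distD (f s) (f t) (g t); have := normr_ge0 (set_val s - set_val t).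
  by rewrite (distrC (f t) (g t)); lra.
have := @graph_dist_ge _ g f tphi.
have := @graph_sup_itv _ f tphi; rewrite ler_norml => /andP[? ?] /andP[? ?].
lra.
Qed.

(* [0] is adjoined so that the supremum makes sense for an empty [B]. *)
Definition cutoff (k : nat) (B : set (skorokhod V)) f :=
  sup (0 |` [set 1 - k%:R * graph_dist f g | g in B]).

Lemma graph_dist_ge0 f g : 0 <= graph_dist f g.
Proof. exact: le_trans (normr_ge0 _) (graph_dist_ge _ _ test_fun0). Qed.

Lemma cutoff_ub k B f : ubound (0 |` [set 1 - k%:R * graph_dist f g | g in B]) 1.
Proof.
by move=> _ [->//|[g _ <-]]; rewrite gerBl mulr_ge0// graph_dist_ge0.
Qed.

Lemma cutoff_ge0 k B f : 0 <= cutoff k B f.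
Proof. by apply: ub_le_sup; [exists 1; exact: cutoff_ub|left]. Qed.

Lemma cutoff_le1 k B f : cutoff k B f <= 1.
Proof. by apply: ge_sup; [exists 0; left|exact: cutoff_ub]. Qed.

Lemma cutoff_ge k B f g : B g -> 1 - k%:R * graph_dist f g <= cutoff k B f.
Proof.
by move=> Bg; apply: ub_le_sup; [exists 1; exact: cutoff_ub|right; exists g].
Qed.

Lemma cutoff_le k B f (b : R) : 0 <= b ->
  (forall g, B g -> 1 - k%:R * graph_dist f g <= b) -> cutoff k B f <= b.
Proof.
move=> b0 h; apply: ge_sup; first by exists 0; left.
by move=> _ [->//|[g Bg <-]]; exact: h.
Qed.

Lemma cutoff_eq1 k B f : B f -> cutoff k B f = 1.
Proof.
move=> Bf; apply/eqP; rewrite eq_le cutoff_le1/=.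
by have := cutoff_ge k f Bf; rewrite graph_distxx mulr0 subr0.
Qed.

Lemma cutoff_eq0 k B f : (0 < k)%N ->
  (forall g, B g -> k%:R^-1 <= graph_dist g f) -> cutoff k B f = 0.
Proof.
move=> k0 h; apply/eqP; rewrite eq_le cutoff_ge0 andbT.
apply: cutoff_le => // g Bg; rewrite subr_le0 graph_distC.
have kR0 : 0 < k%:R :> R by rewrite ltr0n.
by have := h g Bg; rewrite -(ler_pM2l kR0) mulfV// gt_eqF.
Qed.

Lemma cutoff_lipschitz k B f g :
  `|cutoff k B f - cutoff k B g| <= k%:R * graph_dist f g.
Proof.
have h f' g' : cutoff k B f' - cutoff k B g' <= k%:R * graph_dist f' g'.
  rewrite lerBlDr; apply: cutoff_le => [|z Bz].
    by rewrite addr_ge0 ?cutoff_ge0// mulr_ge0// graph_dist_ge0.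
  have := cutoff_ge k g' Bz.
  have : k%:R * graph_dist g' z <= k%:R * (graph_dist f' g' + graph_dist f' z).
    by rewrite ler_wpM2l// [graph_dist f' g']graph_distC graph_dist_triangle.
  rewrite mulrDr; lra.
rewrite ler_norml h andbT; have := h g f; rewrite graph_distC; lra.
Qed.

Lemma cutoff_continuous k B : continuous (cutoff k B).
Proof.
apply: J1_continuous => f_ f /J1_graph_dist df; apply/cvgrPdist_le => e e0.
have : k%:R * graph_dist (f_ n) f @[n --> \oo] --> (k%:R * 0 : R).
  exact: cvgMl_tmp.
rewrite mulr0 => /cvgrPdist_le/(_ e e0); apply: filterS => n.
rewrite sub0r normrN => /(le_trans (ler_norm _)).
by rewrite distrC; apply: le_trans; exact: cutoff_lipschitz.
Qed.

End graph_distance.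

(** * Borel measurability of random paths *)

Section countable_preimage.
Context d (T : measurableType d) (C : countType).

Lemma measurable_preimage_countable (v : T -> C) (A : set C) :
  (forall x, measurable (v @^-1` [set x])) -> measurable (v @^-1` A).
Proof.
move=> mv; rewrite (_ : v @^-1` A = \bigcup_(x : C) (v @^-1` ([set x] `&` A))).
  apply: countable_bigcupT_measurable; first exact: countableP.
  move=> x; have [Ax|nAx] := pselect (A x).
    by rewrite setIidl// => _ ->.
  rewrite (_ : [set x] `&` A = set0) ?preimage_set0//.
  by apply/seteqP; split=> // _ [-> /nAx].
by apply/seteqP; split=> [w Aw|w [x _ []]//]; exists (v w).
Qed.

(** Packs finitely many countable-valued variables into a single one, so that every event about them
    is measurable. *)
Lemma measurable_mkseq (v : nat -> T -> C) :
  (forall k x, measurable (v k @^-1` [set x])) ->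
  forall n s, measurable ((fun w => mkseq (v^~ w) n) @^-1` [set s]).
Proof.
move=> mv; elim=> [|n IH] s.
  case: s => [|x s]; first by rewrite (_ : _ @^-1` _ = setT)// -subTset.
  by rewrite (_ : _ @^-1` _ = set0)// -subset0.
case/lastP: s => [|s x].
  by rewrite (_ : _ @^-1` _ = set0)// -subset0 => w; rewrite /= mkseqS; case: mkseq.
rewrite (_ : _ @^-1` _ =
    (fun w => mkseq (v^~ w) n) @^-1` [set s] `&` v n @^-1` [set x]).
  exact: measurableI.
apply/seteqP; split=> w /=; rewrite mkseqS; first by move=> /rcons_inj[].
by move=> [-> ->].
Qed.

End countable_preimage.

Lemma near_natinv_le (R : realType) (e : R) : 0 < e ->
  \forall n \near \oo, n%:R^-1 <= e.
Proof.
move=> e0; near=> n; rewrite -(invrK e) lef_pV2 ?posrE ?invr_gt0//.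
  by near: n; exact: nbhs_infty_ger.
by rewrite ltr0n; near: n; exists 1%N.
Unshelve. all: by end_near. Qed.

Section step_path_measurable.
Context {R : realType} {V : normedModType R}.

(** As [n] is fixed, a bounded time interval reads only finitely many entries of the sequence. *)
Lemma step_path_stationary (n : nat) (u_ : nat -> nat -> V) (u : nat -> V) :
  (forall j k, (k < j)%N -> u_ j k = u k) ->
  J1_cvg (fun j => step_path n (u_ j)) (step_path n u).
Proof.
move=> uE; apply: unif_J1_cvg => e K e0 K0; near=> j => t tK.
rewrite /= /step_fun uE ?subrr ?normr0 ?ltW//.
apply: (@leq_ltn_trans (Num.truncn (n%:R * K))).
  by apply: le_truncn; rewrite ler_wpM2l.
by near: j; exists (Num.truncn (n%:R * K)).+1.
Unshelve. all: by end_near. Qed.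

(** Membership of a step path in an open set is decided by finitely many entries: otherwise there
    would be, for each [K], a path outside the set with the same first [K] entries, and these paths
    converge to the given one. The preimage is thus a countable union of events about finitely many
    countable-valued variables. *)
Lemma measurable_step_path d (T : measurableType d) (C : countType) (n : nat)
    (v : nat -> T -> C) (c : nat -> C -> V) :
  (forall k x, measurable (v k @^-1` [set x])) ->
  measurable_fun [set: T]
    (fun w => step_path n (fun k => c k (v k w)) : borel (skorokhod V)).
Proof.
move=> mv; apply: (@measurability _ _ T (borel (skorokhod V)) setT _
  (@open (skorokhod V))) => // _ [U oU <-].
rewrite setTI.
pose Q K w := forall u : nat -> V, (forall k, (k < K)%N -> u k = c k (v k w)) ->
  U (step_path n u).
rewrite (_ : _ @^-1` U = \bigcup_K [set w | Q K w]); last first.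
  apply/seteqP; split=> [w Uw|w [K _ Qw]]; last exact: Qw.
  apply: contrapT => nQ.
  have /choice[u uP] K : exists u : nat -> V,
      (forall k, (k < K)%N -> u k = c k (v k w)) /\ ~ U (step_path n u).
    have /existsNP[u /not_implyP[u1 u2]] : ~ Q K w by move=> QK; apply: nQ; exists K.
    by exists u.
  have /oU/(_ Uw)[N _ /(_ N (leqnn _))] :=
    @step_path_stationary n u _ (fun j => (uP j).1).
  exact: (uP N).2.
apply: bigcupT_measurable => K.
(* [Q K w] depends on [w] through the first [K] values only, so the event is the preimage of its own
   image under [mkseq]. *)
rewrite (_ : [set w | Q K w] = (fun w => mkseq (v^~ w) K) @^-1`
    [set mkseq (v^~ w) K | w in [set w | Q K w]]).
  by apply: measurable_preimage_countable; exact: measurable_mkseq.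
apply/seteqP; split=> [w Qw|w [w' Qw' e]]; first by exists w.
move=> u uE; apply: Qw' => k kK; rewrite uE//; congr (c k _).
by rewrite -(nth_mkseq (v 0%N w) (v^~ w) kK) -e nth_mkseq.
Qed.

(** The tolerance [n%:R^-1] leaves room for rounding the values of [f] at the grid times. *)
Lemma step_path_J1_cvg (u : nat -> nat -> V) (f : skorokhod V) : continuous f ->
  (forall n k, (0 < n)%N -> `|u n k - f (to_Rplus (k%:R / n%:R))| <= n%:R^-1) ->
  J1_cvg (fun n => step_path n (u n)) f.
Proof.
move=> cf uf; apply: unif_J1_cvg => e K e0 K0.
have cF : continuous (f \o to_Rplus).
  by move=> x; apply: continuous_comp; [exact: continuous_to_Rplus|exact: cf].
have [r r0 fr] := @continuous_uniform_compact _ _ _ `[0, K] (e / 2) cF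
  (@segment_compact _ 0 K) (divr_gt0 e0 (ltr0n _ 2)).
near=> n => t tK.
have n0 : (0 < n)%N by near: n; exists 1%N.
have nR0 : 0 < n%:R :> R by rewrite ltr0n.
have nr : n%:R^-1 <= r by near: n; exact: near_natinv_le.
have ne : n%:R^-1 <= e / 2.
  by near: n; apply: near_natinv_le; rewrite divr_gt0.
rewrite /= /step_fun; set k := Num.truncn _.
have /andP[kt tk] : k%:R <= n%:R * set_val t < k.+1%:R.
  by rewrite truncn_itv// mulr_ge0// Rplus_ge0.
rewrite (splitr e) (le_trans (ler_distD (f (to_Rplus (k%:R / n%:R))) _ _))//.
rewrite lerD ?(le_trans (uf _ _ n0))//.
have := fr (set_val t) (k%:R / n%:R); rewrite /= set_valK_Rplus distrC; apply.
  by rewrite in_itv/= Rplus_ge0.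
have e1 : set_val t - k%:R / n%:R = (n%:R * set_val t - k%:R) / n%:R.
  by rewrite mulrBl mulrAC mulfV ?mul1r// gt_eqF.
rewrite e1 normrM ger0_norm ?subr_ge0// gtr0_norm ?invr_gt0//.
rewrite (le_trans _ nr)// ler_piMl ?invr_ge0//.
by rewrite lerBlDr ltW// (lt_le_trans tk)// -natr1 addrC.
Unshelve. all: by end_near. Qed.

End step_path_measurable.

Lemma borel_measurable_continuous (R : realType) (E : ptopologicalType)
  (F : E -> R) : continuous F -> measurable_fun setT (F : borel E -> R).
Proof.
move=> /continuousP cF.
apply: (measurability _ (RGenOpens.measurableE R)) => /= _ [_ [x [y ->]] <-].
by rewrite setTI; apply: sub_sigma_algebra; apply: cF; exact: interval_open.
Qed.

Section continuous_path_measurable.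
Context d (T : measurableType d) {R : realType}.
Variables (Z : Rplus R -> T -> R) (cZ : forall w, continuous (fun t => Z t w)).
Hypotheses (mZ : forall t, measurable_fun setT (Z t)).
Hypothesis (Z0 : forall t w, 0 <= Z t w).

Lemma measurable_fun_continuous_path (F : skorokhod R -> R) : continuous F ->
  measurable_fun setT (fun w => F (continuous_path (@cZ w))).
Proof.
move=> cF.
(* The values at the times [k / n] are rounded down to multiples of [1 / n], so that the
   approximating step paths are countable-valued and [measurable_step_path] applies; [F] of the path
   is the pointwise limit of [F] along them. *)
pose v n k w : nat := Num.truncn (n%:R * Z (to_Rplus (k%:R / n%:R)) w).
pose F_ n w := F (step_path n (fun k => (v n k w)%:R / n%:R : R)).
apply: (@measurable_fun_cvg _ _ _ _ F_) => [n|w _].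
  apply: (measurableT_comp (borel_measurable_continuous cF)).
  apply: (@measurable_step_path R R _ _ nat n (v n) (fun _ j => j%:R / n%:R)).
  move=> k j.
  have mnZ : measurable_fun setT (fun w => n%:R * Z (to_Rplus (k%:R / n%:R)) w).
    by apply: measurable_funM => //; exact: measurable_cst.
  rewrite (_ : _ @^-1` _ = (fun w => n%:R * Z (to_Rplus (k%:R / n%:R)) w) @^-1`
     `[j%:R, j.+1%:R[%classic).
    by rewrite -[X in measurable X]setTI; exact: mnZ.
  have nZ0 w : 0 <= n%:R * Z (to_Rplus (k%:R / n%:R)) w by rewrite mulr_ge0.
  apply/seteqP; split=> w /=; rewrite in_itv/= /v.
    by move=> <-; rewrite truncn_itv.
  exact: truncn_def.
apply: continuous_J1 => //; apply: step_path_J1_cvg => [|n k n0].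
  exact: cZ.
rewrite /= /v; set z := Z _ w.
have nR0 : 0 < n%:R :> R by rewrite ltr0n.
have /andP[h1 h2] : (Num.truncn (n%:R * z))%:R <= n%:R * z < (Num.truncn (n%:R * z)).+1%:R.
  by rewrite truncn_itv// mulr_ge0// /z.
rewrite distrC.
have -> : z - (Num.truncn (n%:R * z))%:R / n%:R =
    (n%:R * z - (Num.truncn (n%:R * z))%:R) / n%:R.
  by rewrite mulrBl mulrAC mulfV ?mul1r// gt_eqF.
rewrite normrM ger0_norm ?subr_ge0// gtr0_norm ?invr_gt0//.
rewrite ler_piMl ?invr_ge0//.
by rewrite lerBlDr ltW// (lt_le_trans h2)// -natr1 addrC.
Qed.

(** A continuous path lies in the open set [U] exactly when some cutoff around the complement of [U]
    is below [1] at it. If none were, paths outside [U] at distance less than [1 / (k + 1)] would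
    converge to it locally uniformly. The cutoffs are real functionals, covered by the previous
    lemma. *)
Lemma measurable_continuous_path :
  measurable_fun setT (fun w => continuous_path (@cZ w) : borel (skorokhod R)).
Proof.
apply: (@measurability _ _ T (borel (skorokhod R)) setT _
  (@open (skorokhod R))) => // _ [U oU <-].
rewrite setTI.
rewrite (_ : _ @^-1` U = \bigcup_k
    [set w | cutoff k.+1 (~` U) (continuous_path (@cZ w)) < 1]); last first.
  apply/seteqP; split=> [w Uw|w [k _] /= c1]; last first.
    by apply: contrapT => nU; move: c1; rewrite cutoff_eq1// ltxx.
  apply: contrapT => nk.
  have /choice[g gP] k : exists g, ~ U g /\
      graph_dist g (continuous_path (@cZ w)) < k.+1%:R^-1.
    apply: contrapT => /forallNP ng; apply: nk; exists k => //=.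
    rewrite cutoff_eq0// => g nUg; rewrite leNgt; apply/negP => gk.
    by apply: (ng g).
  have gw : J1_cvg g (continuous_path (@cZ w)).
    apply: unif_J1_cvg => e K e0 K0.
    have [|r r0 hr] := @graph_dist_unif _ _ (continuous_path (@cZ w)) K e _ (ltW K0) e0.
      exact: cZ.
    have := near_infty_natSinv_lt (PosNum r0).
    by apply: filterS => k kr; apply: hr; rewrite (lt_trans (gP k).2).
  have [N _ /(_ N (leqnn _))] := oU _ _ gw Uw.
  exact: (gP N).1.
apply: bigcupT_measurable => k.
rewrite -[X in measurable X]setTI.
have := @measurable_fun_continuous_path _ (@cutoff_continuous _ _ k.+1 (~` U)).
move=> /(_ measurableT `]-oo, 1[%classic); rewrite set_itvE; apply.
by rewrite -set_itvNyo; exact: measurable_itv.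
Qed.

End continuous_path_measurable.

(** * Independence in the Galton-Watson process *)

Section discrete_partition.
Context d (T : measurableType d) (R : realType) (P : probability T R).
Local Open Scope ereal_scope.

Lemma bigcup_preimage_nat (A : set T) (v : T -> nat) :
  A = \bigcup_n (A `&` v @^-1` [set n]).
Proof. by apply/seteqP; split=> [w Aw|w [n _ []]//]; exists (v w). Qed.

Lemma trivIset_preimage_nat (A : set T) (v : T -> nat) :
  trivIset setT (fun n => A `&` v @^-1` [set n]).
Proof. by move=> i j _ _ [w [[_ <-] [_ <-]]]. Qed.

Lemma measurable_pickle (C : countType) (v : T -> C) :
  (forall x, measurable (v @^-1` [set x])) ->
  forall n, measurable ((fun w => choice.pickle (v w)) @^-1` [set n]).
Proof.
move=> mv n; exact: (measurable_preimage_countable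
  [set x | choice.pickle x = n] mv).
Qed.

(** Total probability over the fibres of [v], indexed by their [pickle] codes; codes that are not
    attained have empty fibres. *)
Lemma probability_eq_mul_partition (C : countType) (v : T -> C) (A B : set T)
    (c : R) : measurable A -> measurable B -> (0 <= c)%R ->
  (forall x, measurable (v @^-1` [set x])) ->
  (forall x, P (A `&` v @^-1` [set x]) = c%:E * P (B `&` v @^-1` [set x])) ->
  P A = c%:E * P B.
Proof.
move=> mA mB c0 mv h; have mp := measurable_pickle mv.
rewrite (bigcup_preimage_nat A (choice.pickle \o v)) (bigcup_preimage_nat B (choice.pickle \o v)).
rewrite !measure_bigcup//; try by [move=> ? _; exact: measurableI
  |exact: trivIset_preimage_nat].
rewrite -nneseriesZl//; apply: eq_eseriesr => n _.
have [[x xn]|nx] := pselect (exists x : C, choice.pickle x = n).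
  suff -> : (choice.pickle \o v) @^-1` [set n] = v @^-1` [set x] by exact: h.
  apply/seteqP; split=> w /=; last by move=> ->.
  by rewrite -xn => /(pcan_inj choice.pickleK).
have -> : (choice.pickle \o v) @^-1` [set n] = set0.
  by rewrite -subset0 => w /= e; apply: nx; exists (v w).
by rewrite !setI0 measure0 mule0.
Qed.

Lemma ge0_integral_partition (v : T -> nat) (A : set T) (f : T -> \bar R) :
  measurable A -> (forall n, measurable (v @^-1` [set n])) ->
  measurable_fun A f -> (forall w, 0 <= f w) ->
  \int[P]_(w in A) f w = \sum_(n <oo) \int[P]_(w in A `&` v @^-1` [set n]) f w.
Proof.
move=> mA mv mf f0; rewrite {1}(bigcup_preimage_nat A v) ge0_integral_bigcup//.
- by move=> n; exact: measurableI.
- by rewrite -bigcup_preimage_nat.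
- exact: trivIset_preimage_nat.
Qed.

End discrete_partition.

Section GW_independence.
Context d (T : measurableType d) (R : realType) (P : probability T R).
Variables (xi : nat -> nat -> {RV P >-> nat}) (Y : nat -> {RV P >-> nat}).
Variable X : nat -> T -> nat.
Hypothesis GW : GW_immigration xi Y X.
Local Open Scope ereal_scope.

Let xi' (kj : nat * nat) := xi kj.1 kj.2.
Let pos := [set kj : nat * nat | (0 < kj.1)%N /\ (0 < kj.2)%N].
Let sigY := sigma_generated setT Y.

Let rv_nat_measurable (Z : {RV P >-> nat}) (A : set nat) :
  measurable (Z @^-1` A).
Proof. by rewrite -[X in measurable X]setTI; exact: (measurable_funPT Z). Qed.

Lemma sigY_measurable A : sigY A -> measurable A.
Proof.
apply: smallest_sub; first exact: sigma_algebra_measurable.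
by move=> _ [k _ [B mB <-]]; rewrite setTI; exact: rv_nat_measurable.
Qed.

Lemma sigYI A B : sigY A -> sigY B -> sigY (A `&` B).
Proof. exact: (@measurableI _ (g_sigma_algebraType
  (\bigcup_(i in setT) preimage_set_system setT (Y i) measurable))). Qed.

Lemma sigY_preimage k (B : set nat) : sigY (Y k @^-1` B).
Proof.
apply: sub_sigma_algebra; exists k => //; exists B => //.
by rewrite setTI.
Qed.

Lemma sigYT : sigY setT.
Proof. exact: (@measurableT _ (g_sigma_algebraType
  (\bigcup_(i in setT) preimage_set_system setT (Y i) measurable))). Qed.

Lemma GW_measurable k r : measurable (X k @^-1` [set r]).
Proof.
case: GW => _ _ _ X0 XS; elim: k r => [|k IH] r.
  have [->|r0] := eqVneq r 0%N.
    by rewrite (_ : _ @^-1` _ = setT)// -subTset => w _; exact: X0.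
  rewrite (_ : _ @^-1` _ = set0)// -subset0 => w /=.
  by rewrite X0 => /esym/eqP; rewrite (negbTE r0).
pose v i := if i is i'.+1 then xi k.+1 i : T -> nat else Y k : T -> nat.
pose A x := [set s : seq nat | (\sum_(1 <= j < x.+1) nth 0 s j + nth 0 s 0 = r)%N].
rewrite (_ : _ @^-1` _ = \bigcup_x (X k @^-1` [set x] `&`
    (fun w => mkseq (v^~ w) x.+1) @^-1` (A x))).
  apply: bigcupT_measurable => x; apply: measurableI => //.
  apply: measurable_preimage_countable; apply: measurable_mkseq => -[|i] j;
  exact: rv_nat_measurable.
have E x w : (\sum_(1 <= j < x.+1) nth 0 (mkseq (v^~ w) x.+1) j +
    nth 0 (mkseq (v^~ w) x.+1) 0 = \sum_(1 <= j < x.+1) xi k.+1 j w + Y k w)%N.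
  rewrite nth_mkseq//; congr addn; apply: eq_big_nat => -[|i]// /andP[_ ix].
  by rewrite nth_mkseq.
apply/seteqP; split=> [w Xr|w [x _ [/= Xx Ar]]].
  by exists (X k w) => //; split => //; rewrite /A /= E -XS.
by move: Ar; rewrite /A /= E XS Xx.
Qed.

Let cyl (J : {fset nat * nat}) (B : nat * nat -> set nat) :=
  \bigcap_(i in [set` J]) (xi' i @^-1` B i).

Let cyl_measurable J B : measurable (cyl J B).
Proof.
apply: fin_bigcap_measurable; first exact: finite_fset.
by move=> i _; exact: rv_nat_measurable.
Qed.

Let prod_fin (J : seq (nat * nat)) (B : nat * nat -> set nat) :
  \prod_(i <- J) P (xi' i @^-1` B i) \is a fin_num.
Proof. by apply: prode_fin_num => i _; exact: fin_num_measure. Qed.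

Let cylU (J J' : {fset nat * nat}) B B' B'' :
  {in J, B'' =1 B} -> {in J', B'' =1 B'} ->
  cyl (J `|` J')%fset B'' = cyl J B `&` cyl J' B'.
Proof.
move=> e e'; apply/seteqP; split=> [w h|w [h h'] i /=].
  by split=> i /= iJ; [rewrite -e//|rewrite -e'//]; apply: h; rewrite /= inE iJ ?orbT.
by rewrite inE => /orP[iJ|iJ]; [rewrite e//; exact: h|rewrite e'//; exact: h'].
Qed.

Let prodU (J J' : {fset nat * nat}) B B' B'' : [disjoint J & J']%fset ->
  {in J, B'' =1 B} -> {in J', B'' =1 B'} ->
  \prod_(i <- (J `|` J')%fset) P (xi' i @^-1` B'' i) =
  \prod_(i <- J) P (xi' i @^-1` B i) * \prod_(i <- J') P (xi' i @^-1` B' i).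
Proof.
move=> /fdisjointP JJ' e e'; rewrite (perm_big (J ++ J'))/=.
  rewrite big_cat; congr (_ * _); rewrite big_seq [RHS]big_seq.
    by apply: eq_bigr => i iJ; rewrite e.
  by apply: eq_bigr => i iJ; rewrite e'.
apply: uniq_perm; rewrite ?fset_uniq//.
  rewrite cat_uniq !fset_uniq andbT/=; apply/hasPn => i iJ'; apply/negP => iJ.
  by move: (JJ' _ iJ); rewrite iJ'.
by move=> i; rewrite mem_cat inE.
Qed.

(** Induction on [k]. The event [C] of the immigration process is there for the induction: the step
    conditions on [Y k], and this event is absorbed into [C]. For [k = 0] the claim is the
    independence of offspring and immigration. *)
Lemma GW_future_indep k (J : {fset nat * nat}) (B : nat * nat -> set nat)
    (C : set T) r :
  (forall i, i \in J -> (k < i.1)%N /\ (0 < i.2)%N) -> sigY C ->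
  P (X k @^-1` [set r] `&` C `&` \bigcap_(i in [set` J]) (xi' i @^-1` B i)) =
  \prod_(i <- J) P (xi' i @^-1` B i) * P (X k @^-1` [set r] `&` C).
Proof.
case: GW => mi _ indep X0 XS.
elim: k J B C r => [|k IH] J B C r kJ sC.
  have [->|r0] := eqVneq r 0%N; last first.
    rewrite (_ : _ @^-1` _ = set0) ?set0I ?measure0 ?mule0//.
    rewrite -subset0 => w /=.
    by rewrite X0 => /esym/eqP; rewrite (negbTE r0).
  rewrite (_ : _ @^-1` _ = setT) ?setTI; last first.
    by rewrite -subTset => w _; exact: X0.
  have cJ : sigma_generated pos xi' (cyl J B).
    apply: (@fin_bigcap_measurable _ (g_sigma_algebraType (\bigcup_(i in pos)
      preimage_set_system setT (xi' i) measurable))); first exact: finite_fset.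
    move=> i iJ; apply: sub_sigma_algebra; exists i; first exact: (kJ i iJ).
    by exists (B i) => //; rewrite setTI.
  by rewrite setIC indep// mi// => i iJ; exact: (kJ i iJ).
(* A countable-valued variable that determines [X k.+1]. Each fibre is either empty or the
   intersection of an event on [X k], one on [Y k] and a cylinder in generation [k.+1], which is a
   form the induction hypothesis accepts. *)
pose v w := (X k w, Y k w, mkseq (fun j => xi k.+1 j.+1 w) (X k w)).
pose J0 x := [fset ((k.+1, j.+1) : nat * nat) | j in iota 0 x]%fset.
pose B0 (e : seq nat) (i : nat * nat) := [set nth 0%N e i.2.-1].
have inJ0 x i : i \in J0 x -> i.1 = k.+1 /\ (0 < i.2 <= x)%N.
  by move=> /imfsetP[j /=]; rewrite mem_iota => /andP[_ jx] ->.
have vE x y e : v @^-1` [set (x, y, e)] = if size e == x then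
    X k @^-1` [set x] `&` Y k @^-1` [set y] `&` cyl (J0 x) (B0 e) else set0.
  case: eqVneq => [xe|xe]; last first.
    rewrite -subset0 => w [Xx _ we].
    by move: xe; rewrite -we size_mkseq Xx eqxx.
  apply/seteqP; split=> w /=.
    move=> [Xx Yy ee]; split; first by split.
    move=> i iJ0; have [i1 /andP[i2 i2x]] := inJ0 x i iJ0.
    by rewrite -ee Xx /B0 /= nth_mkseq ?prednK// /xi' i1.
  move=> [[Xx Yy] h]; rewrite /v Xx Yy; congr (_, _, _).
  apply: (@eq_from_nth _ 0%N); rewrite size_mkseq ?xe// => j jx.
  rewrite nth_mkseq//; apply: (h (k.+1, j.+1)) => /=.
  by apply/imfsetP; exists j => //=; rewrite mem_iota.
have vm c : measurable (v @^-1` [set c]).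
  case: c => [[x y] e]; rewrite vE; case: ifP => // _.
  apply: measurableI; last exact: cyl_measurable.
  by apply: measurableI; [exact: GW_measurable|exact: rv_nat_measurable].
have Xv w : X k.+1 w = (\sum_(1 <= j < (v w).1.1.+1) nth 0 (v w).2 j.-1 + (v w).1.2)%N.
  rewrite XS; congr addn; apply: eq_big_nat => -[|j]// /andP[_ jx].
  by rewrite /= nth_mkseq.
rewrite -(fineK (prod_fin J B)).
apply: (probability_eq_mul_partition (v := v)) => //.
- apply: measurableI; last exact: cyl_measurable.
  by apply: measurableI; [exact: GW_measurable|exact: sigY_measurable].
- by apply: measurableI; [exact: GW_measurable|exact: sigY_measurable].
- by rewrite fine_ge0// prode_ge0.
move=> [[x y] e]; rewrite fineK//.
have [re|re] := eqVneq r (\sum_(1 <= j < x.+1) nth 0 e j.-1 + y)%N; last first.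
  have h D : X k.+1 @^-1` [set r] `&` D `&` v @^-1` [set (x, y, e)] = set0.
    rewrite -subset0 => w [[/= Xr _] ve]; move: re.
    by rewrite -Xr Xv ve eqxx.
  by rewrite -(setIA _ C) !h measure0 mule0.
have [xe|xe] := eqVneq (size e) x; last first.
  by rewrite vE (negbTE xe) !setI0 measure0 mule0.
have h D : X k.+1 @^-1` [set r] `&` D `&` v @^-1` [set (x, y, e)] =
   D `&` v @^-1` [set (x, y, e)].
  apply/seteqP; split=> [w [[_ ?]] ?//|w [Dw ve]]; do 2!split => //=.
  by rewrite Xv ve re.
rewrite -(setIA _ C) !h vE xe eqxx.
(* [J0 x] lies in generation [k.+1] and [J] strictly after it, so both constraints merge into one
   cylinder, and the product over the union splits. *)
pose B' i := if i.1 == k.+1 then B0 e i else B i.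
have eB0 : {in J0 x, B' =1 B0 e} by move=> i /inJ0[e1 _]; rewrite /B' e1 eqxx.
have eB : {in J, B' =1 B}.
  by move=> i /kJ[e1 _]; rewrite /B' gtn_eqF.
have dJ : [disjoint J0 x & J]%fset.
  apply/fdisjointP => i /inJ0[i1 _]; apply/negP => /kJ[].
  by rewrite i1 ltnn.
have sCY : sigY (C `&` Y k @^-1` [set y]).
  by apply: sigYI => //; exact: sigY_preimage.
have -> : C `&` cyl J B `&` (X k @^-1` [set x] `&` Y k @^-1` [set y] `&`
    cyl (J0 x) (B0 e)) = X k @^-1` [set x] `&` (C `&` Y k @^-1` [set y]) `&`
    cyl (J0 x `|` J)%fset B'.
  by rewrite (cylU eB0 eB); apply/seteqP; split=> w /=; tauto.
have -> : C `&` (X k @^-1` [set x] `&` Y k @^-1` [set y] `&`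
    cyl (J0 x) (B0 e)) = X k @^-1` [set x] `&` (C `&` Y k @^-1` [set y]) `&`
    cyl (J0 x) (B0 e).
  by apply/seteqP; split=> w /=; tauto.
rewrite !IH//.
- by rewrite (prodU dJ eB0 eB) muleA [X in X * _]muleC.
- by move=> i /inJ0[-> /andP[]].
- move=> i; rewrite inE => /orP[/inJ0[-> /andP[]]//|/kJ[/ltnW]].
  by [].
Qed.

End GW_independence.

(** * Moments *)

Lemma measurable_fun_countable d d' (T : measurableType d)
    (T' : measurableType d') (C : countType) (v : T -> C) (g : C -> T') :
  (forall x, measurable (v @^-1` [set x])) ->
  measurable_fun setT (fun w => g (v w)).
Proof.
move=> mv _ B mB; rewrite setTI.
exact: (measurable_preimage_countable (g @^-1` B) mv).
Qed.

Section discrete_integrals.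
Context d (T : measurableType d) (R : realType) (P : probability T R).
Local Open Scope ereal_scope.

Lemma ge0_integral_nat (A : set T) (U : T -> nat) (f : nat -> R) :
  measurable A -> (forall n, measurable (U @^-1` [set n])) ->
  (forall n, 0 <= f n)%R ->
  \int[P]_(w in A) (f (U w))%:E = \sum_(n <oo) (f n)%:E * P (A `&` U @^-1` [set n]).
Proof.
move=> mA mU f0; rewrite (ge0_integral_partition P (v := U))//.
- apply: eq_eseriesr => n _.
  rewrite -integral_cst; last exact: measurableI.
  by apply: eq_integral => w; rewrite inE => -[_ /= ->].
- apply/measurable_EFinP; apply: measurable_funTS.
  exact: measurable_fun_countable.
- by move=> w; rewrite lee_fin.
Qed.

Lemma ge0_integral_indep (A : set T) (U W : T -> nat) (f : nat -> R) (c : R) :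
  measurable A -> (forall n, measurable (U @^-1` [set n])) ->
  (forall n, measurable (W @^-1` [set n])) ->
  (forall n, 0 <= f n)%R -> (0 <= c)%R ->
  (forall n, P (A `&` U @^-1` [set n]) = c%:E * P (W @^-1` [set n])) ->
  \int[P]_(w in A) (f (U w))%:E = c%:E * \int[P]_w (f (W w))%:E.
Proof.
move=> mA mU mW f0 c0 h; rewrite !ge0_integral_nat// -nneseriesZl//.
  by apply: eq_eseriesr => n _; rewrite h setTI muleCA.
by move=> n _; rewrite mule_ge0// lee_fin.
Qed.

(** Restricting to [U = n] reduces to one variable, with the constant [c] multiplied by the
    probability of [W = n]. *)
Lemma ge0_integral_indep2 (A : set T) (U V W : T -> nat) (f g : nat -> R)
    (c : R) (y : R) :
  measurable A -> (forall n, measurable (U @^-1` [set n])) ->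
  (forall n, measurable (V @^-1` [set n])) ->
  (forall n, measurable (W @^-1` [set n])) ->
  (forall n, 0 <= f n)%R -> (forall n, 0 <= g n)%R -> (0 <= c)%R ->
  (forall n p, P (A `&` U @^-1` [set n] `&` V @^-1` [set p]) =
    c%:E * P (W @^-1` [set n]) * P (W @^-1` [set p])) ->
  \int[P]_w (g (W w))%:E = y%:E ->
  \int[P]_(w in A) (f (U w) * g (V w))%:E =
  (c * y)%:E * \int[P]_w (f (W w))%:E.
Proof.
move=> mA mU mV mW f0 g0 c0 h yE.
have y0 : (0 <= y)%R.
  by rewrite -lee_fin -yE integral_ge0// => w _; rewrite lee_fin.
rewrite (ge0_integral_partition P (v := U))//; last 2 first.
- apply/measurable_EFinP; apply: measurable_funTS.
  by apply: measurable_funM; exact: measurable_fun_countable.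
- by move=> w; rewrite lee_fin mulr_ge0.
rewrite (ge0_integral_nat _ mW)// -nneseriesZl; last first.
  by move=> n _; rewrite mule_ge0// lee_fin.
apply: eq_eseriesr => n _; rewrite setTI.
have mAU : measurable (A `&` U @^-1` [set n]) by exact: measurableI.
transitivity (\int[P]_(w in A `&` U @^-1` [set n]) ((f n)%:E * (g (V w))%:E)).
  by apply: eq_integral => w; rewrite inE => -[_ /= ->].
rewrite ge0_integralZl//; last 3 first.
- apply/measurable_EFinP; apply: measurable_funTS.
  exact: measurable_fun_countable.
- by move=> w _; rewrite lee_fin.
- by rewrite lee_fin.
rewrite (@ge0_integral_indep _ V W g (c * fine (P (W @^-1` [set n]))))//.
- rewrite yE -[in RHS](fineK (fin_num_measure P _ (mW n))) -!EFinM.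
  by congr (_%:E); ring.
- by rewrite mulr_ge0// fine_ge0.
- by move=> p; rewrite h EFinM fineK// fin_num_measure.
Qed.

Lemma integral_sqr_center (A : set T) (Z : T -> R) (c p z1 z2 : R) :
  measurable A -> measurable_fun setT Z -> (forall w, 0 <= Z w)%R -> (0 <= c)%R ->
  P A = p%:E -> \int[P]_(w in A) (Z w)%:E = z1%:E ->
  \int[P]_(w in A) (Z w ^+ 2)%:E = z2%:E ->
  \int[P]_(w in A) ((Z w - c) ^+ 2)%:E = (z2 - 2 * c * z1 + c ^+ 2 * p)%:E.
Proof.
move=> mA mZ Z0 c0 pE z1E z2E.
have mZ2 : measurable_fun A (fun w => (Z w ^+ 2)%:E).
  by apply/measurable_EFinP/measurable_funTS; exact: measurable_funX.
have mZc : measurable_fun A (fun w => ((Z w - c) ^+ 2)%:E).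
  by apply/measurable_EFinP/measurable_funTS; apply: measurable_funX; exact: measurable_funB.
have mZ1 : measurable_fun A (fun w => (Z w)%:E).
  by apply/measurable_EFinP/measurable_funTS.
have c2 : (0 <= 2 * c)%R by rewrite mulr_ge0.
have mZ1c : measurable_fun A (fun w => (2 * c)%:E * (Z w)%:E).
  exact: measurable_funeM.
(* The cross term is moved to the left, so that all integrands are nonnegative and additivity holds
   before the left integral is known to be finite. *)
have : \int[P]_(w in A) (((Z w - c) ^+ 2)%:E + (2 * c)%:E * (Z w)%:E) =
       \int[P]_(w in A) ((Z w ^+ 2)%:E + (c ^+ 2)%:E).
  by apply: eq_integral => w _; rewrite -EFinM -!EFinD; congr (_%:E); ring.
rewrite ge0_integralD//; last 2 first.
- by move=> w _; rewrite lee_fin sqr_ge0.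
- by move=> w _; rewrite mule_ge0 ?lee_fin.
rewrite ge0_integralD//; last 2 first.
- by move=> w _; rewrite lee_fin sqr_ge0.
- by move=> w _; rewrite lee_fin sqr_ge0.
rewrite ge0_integralZl_EFin//; last by move=> w _; rewrite lee_fin.
have cE : \int[P]_(w in A) (c ^+ 2)%:E = (c ^+ 2 * p)%:E.
  by rewrite (EFinM (c ^+ 2)) -pE; exact: integral_cst.
rewrite z1E z2E cE -EFinM -EFinD.
case: (\int[P]_(w in A) _) => [x| |]//.
by rewrite -EFinD => -[/eqP]; rewrite -subr_eq => /eqP <-; congr (_%:E); ring.
Qed.

End discrete_integrals.

Section GW_moments.
Context d (T : measurableType d) (R : realType) (P : probability T R).
Variables (xi : nat -> nat -> {RV P >-> nat}) (Y : nat -> {RV P >-> nat}).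
Variable X : nat -> T -> nat.
Hypothesis GW : GW_immigration xi Y X.
Variables (mu s2 : R).
Local Open Scope ereal_scope.
Hypothesis mean_xi : \int[P]_w (xi 1 1 w)%:R%:E = mu%:E.
Hypothesis moment2_xi : \int[P]_w ((xi 1 1 w)%:R ^+ 2)%:E = s2%:E.

Let rv_measurable (Z : {RV P >-> nat}) n : measurable (Z @^-1` [set n]).
Proof. by rewrite -[X in measurable X]setTI; exact: (measurable_funPT Z). Qed.

Let X_measurable := GW_measurable GW.

Lemma GW_indep1 k r i (B : set nat) : (0 < i)%N ->
  P (X k @^-1` [set r] `&` xi k.+1 i @^-1` B) =
  P (X k @^-1` [set r]) * P (xi 1 1 @^-1` B).
Proof.
move=> i0.
have := GW_future_indep GW (k := k) (J := [fset (k.+1, i)]%fset) (fun=> B) r _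
  (@sigYT _ _ _ P Y).
rewrite setIT big_seq_fset1/= => h.
have <- : P (xi k.+1 i @^-1` B) = P (xi 1 1 @^-1` B).
  by case: GW => _ /(_ (k.+1, i)) id _ _ _; exact: (id _ B).
rewrite muleC -h; last by move=> _ /fset1P ->.
congr (P (_ `&` _)); apply/seteqP; split=> [w Bw _ /fset1P -> //|w].
by move=> /(_ (k.+1, i)); apply; exact/fset1P.
Qed.

Lemma GW_indep2 k r i j (B C : set nat) : (0 < i)%N -> (0 < j)%N -> i != j ->
  P (X k @^-1` [set r] `&` xi k.+1 i @^-1` B `&` xi k.+1 j @^-1` C) =
  P (X k @^-1` [set r]) * P (xi 1 1 @^-1` B) * P (xi 1 1 @^-1` C).
Proof.
move=> i0 j0 ij.
pose D ab := if ab == (k.+1, i) then B else C.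
have := GW_future_indep GW (k := k) (J := [fset (k.+1, i); (k.+1, j)]%fset) D r _
  (@sigYT _ _ _ P Y).
have ijk : (k.+1, i) != (k.+1, j) by rewrite xpair_eqE eqxx.
have D1 : D (k.+1, i) = B by rewrite /D eqxx.
have D2 : D (k.+1, j) = C by rewrite /D eq_sym (negbTE ijk).
rewrite setIT big_fsetU1/=; last by rewrite inE.
rewrite big_seq_fset1/= D1 D2 => h.
have idl l E : (0 < l)%N -> P (xi k.+1 l @^-1` E) = P (xi 1 1 @^-1` E).
  by move=> l0; case: GW => _ /(_ (k.+1, l)) id _ _ _; exact: (id _ E).
rewrite -(idl i)// -(idl j)// -muleA muleC -h; last first.
  by move=> _ /fset2P[] ->.
congr (P _); rewrite -setIA; congr (_ `&` _); apply/seteqP; split=> [w [Bw Cw]|w].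
  by move=> _ /fset2P[] ->; rewrite /= ?D1 ?D2.
move=> h'; split.
  have := h' (k.+1, i); rewrite /= D1; apply; apply/fset2P; by left.
have := h' (k.+1, j); rewrite /= D2; apply; apply/fset2P; by right.
Qed.

(** The number of parents is frozen at [r]; on the event [X k = r] this is the total offspring in
    generation [k.+1]. *)
Let S k r w : R := (\sum_(j < r) (xi k.+1 j.+1 w)%:R)%R.

Let mxi k i : measurable_fun setT (fun w => (xi k i w)%:R : R).
Proof.
apply: (@measurable_fun_countable _ _ _ _ nat (xi k i) (fun n => n%:R : R)).
exact: rv_measurable.
Qed.

Let mY k : measurable_fun setT (fun w => (Y k w)%:R : R).
Proof.
apply: (@measurable_fun_countable _ _ _ _ nat (Y k) (fun n => n%:R : R)).
exact: rv_measurable.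
Qed.

Let mS k r : measurable_fun setT (S k r).
Proof. exact: measurable_sum. Qed.

Let S_ge0 k r w : (0 <= S k r w)%R.
Proof. exact: sumr_ge0. Qed.

Let p k r := fine (P (X k @^-1` [set r])).

Let pE k r : P (X k @^-1` [set r]) = (p k r)%:E.
Proof. by rewrite fineK// fin_num_measure. Qed.

Let p_ge0 k r : (0 <= p k r)%R.
Proof. exact: fine_ge0. Qed.

Let mean_S k r :
  \int[P]_(w in X k @^-1` [set r]) (S k r w)%:E = (p k r * (r%:R * mu))%:E.
Proof.
under eq_integral do rewrite /S -sumEFin.
rewrite ge0_integral_sum//; last first.
  by move=> i; apply/measurable_EFinP/measurable_funTS.
under eq_bigr => i _.
  rewrite (ge0_integral_indep (f := fun n => n%:R) _ _
    (rv_measurable (xi 1 1)) _ (p_ge0 k r))//; last first.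
    by move=> n; rewrite GW_indep1// pE.
  rewrite mean_xi.
  over.
by rewrite -EFinM sumEFin sumr_const card_ord; congr (_%:E); ring.
Qed.

(** Expanding the square gives [r] diagonal terms of mean [s2] and [r ^ 2 - r] other terms of mean
    [mu ^ 2], by independence of two offspring variables and [X k]. *)
Let moment2_S k r :
  \int[P]_(w in X k @^-1` [set r]) (S k r w ^+ 2)%:E =
  (p k r * (r%:R * s2 + (r%:R ^+ 2 - r%:R) * mu ^+ 2))%:E.
Proof.
transitivity (\int[P]_(w in X k @^-1` [set r])
   \sum_(i < r) \sum_(j < r) ((xi k.+1 i.+1 w)%:R * (xi k.+1 j.+1 w)%:R)%:E).
  apply: eq_integral => w _; under eq_bigr do rewrite sumEFin.
  rewrite sumEFin expr2 /S mulr_suml; congr (_%:E); apply: eq_bigr => i _.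
  by rewrite mulr_sumr.
have mij i j : measurable_fun (X k @^-1` [set r])
   (fun w => ((xi k.+1 i w)%:R * (xi k.+1 j w)%:R : R)%:E).
  by apply/measurable_EFinP/measurable_funTS; exact: measurable_funM.
rewrite ge0_integral_sum//; last 2 first.
- by move=> i; apply: emeasurable_sum.
- by move=> i w _; apply: sume_ge0 => j _; rewrite lee_fin.
transitivity (\sum_(i < r) \sum_(j < r)
   (p k r * (if j == i then s2 else mu ^+ 2))%:E).
  apply: eq_bigr => i _; rewrite ge0_integral_sum//.
  apply: eq_bigr => j _; case: eqVneq => [->|ij].
    under eq_integral do rewrite -expr2.
    rewrite (ge0_integral_indep (f := fun n => (n%:R ^+ 2)%R) _ _
      (rv_measurable (xi 1 1)) _ (p_ge0 k r))//.
    + by rewrite moment2_xi.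
    + by move=> n; rewrite GW_indep1// pE.
  rewrite (ge0_integral_indep2 (f := fun n => n%:R) (g := fun n => n%:R) _ _ _
      (rv_measurable (xi 1 1)) _ _ (p_ge0 k r) _ mean_xi)//.
    by rewrite mean_xi -EFinM; congr (_%:E); ring.
  by move=> n q; rewrite GW_indep2// ?pE// eqSS eq_sym.
under eq_bigr do rewrite sumEFin -mulr_sumr.
rewrite sumEFin -mulr_sumr; congr ((_ * _)%:E).
have h (i : 'I_r) : (\sum_(j < r) (if j == i then s2 else mu ^+ 2) =
    s2 + (r%:R - 1) * mu ^+ 2)%R.
  rewrite (bigD1 i)//= eqxx; congr (_ + _)%R.
  rewrite (eq_bigr (fun=> mu ^+ 2)%R); last by move=> j /negbTE ->.
  rewrite sumr_const cardC1 card_ord -[in LHS]mulr_natl.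
  have r0 : (0 < r)%N := leq_ltn_trans (leq0n i) (ltn_ord i).
  by rewrite -[in RHS](prednK r0) -natr1 addrK.
by rewrite (eq_bigr _ (fun i _ => h i)) sumr_const card_ord -mulr_natl; ring.
Qed.

Let variance_S k r :
  \int[P]_(w in X k @^-1` [set r]) ((S k r w - r%:R * mu) ^+ 2)%:E =
  (p k r * (r%:R * (s2 - mu ^+ 2)))%:E.
Proof.
have mu0 : (0 <= mu)%R.
  by rewrite -lee_fin -mean_xi integral_ge0// => w _; rewrite lee_fin.
rewrite (integral_sqr_center (X_measurable k r) (mS k r) (S_ge0 k r) _
  (pE k r) (mean_S k r) (moment2_S k r)); last by rewrite mulr_ge0.
by congr (_%:E); ring.
Qed.

Let XS k w : ((X k.+1 w)%:R = S k (X k w) w + (Y k w)%:R :> R)%R.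
Proof.
by case: GW => _ _ _ _ ->; rewrite natrD natr_sum big_add1 big_mkord.
Qed.

Definition GW_noise k w : R :=
  ((X k.+1 w)%:R - mu * (X k w)%:R - (Y k w)%:R)%R.

Lemma measurable_GW k : measurable_fun setT (fun w => (X k w)%:R : R).
Proof.
apply: (@measurable_fun_countable _ _ _ _ nat (X k) (fun n => n%:R : R)).
exact: X_measurable.
Qed.

Lemma measurable_GW_noise k : measurable_fun setT (GW_noise k).
Proof.
apply: measurable_funB.
  apply: measurable_funB; first exact: measurable_GW.
  by apply: measurable_funM; [exact: measurable_cst|exact: measurable_GW].
exact: mY.
Qed.

(** On [X k = r] the noise is a sum of [r] independent centred terms, of total variance
    [r * (s2 - mu ^ 2)]. The equality is in the extended reals, whether or not the mean of [X k] is
    finite. *)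
Lemma variance_GW_noise k :
  \int[P]_w (GW_noise k w ^+ 2)%:E = (s2 - mu ^+ 2)%:E * \int[P]_w (X k w)%:R%:E.
Proof.
rewrite (ge0_integral_partition P (v := X k))//; last 2 first.
- by apply/measurable_EFinP; apply: measurable_funX; exact: measurable_GW_noise.
- by move=> w; rewrite lee_fin sqr_ge0.
rewrite (ge0_integral_nat (f := fun n => n%:R) P _ (X_measurable k))//.
rewrite -nneseriesZl//; last by move=> n _; rewrite mule_ge0// lee_fin.
apply: eq_eseriesr => r _; rewrite !setTI pE.
transitivity (\int[P]_(w in X k @^-1` [set r]) ((S k r w - r%:R * mu) ^+ 2)%:E).
  apply: eq_integral => w; rewrite inE /= => Xr.
  by rewrite /GW_noise XS Xr; congr (_%:E); ring.
by rewrite variance_S -!EFinM; congr (_%:E); ring.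
Qed.

Lemma mean_GW_succ k : \int[P]_w (X k.+1 w)%:R%:E =
  mu%:E * \int[P]_w (X k w)%:R%:E + \int[P]_w (Y k w)%:R%:E.
Proof.
transitivity (\int[P]_w ((S k (X k w) w)%:E + (Y k w)%:R%:E)).
  by apply: eq_integral => w _; rewrite XS EFinD.
have mSX : measurable_fun setT (fun w => (S k (X k w) w)%:E).
  apply/measurable_EFinP.
  rewrite (_ : (fun w => _) = fun w => ((X k.+1 w)%:R - (Y k w)%:R)%R).
    apply: measurable_funB; first exact: measurable_GW.
    exact: mY.
  by apply/funext => w; rewrite XS addrK.
rewrite ge0_integralD//; last 2 first.
- by move=> w _; rewrite lee_fin.
- by apply/measurable_EFinP; exact: mY.
congr (_ + _).
rewrite [LHS](ge0_integral_partition P (v := X k))//; last first.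
  by move=> w; rewrite lee_fin.
rewrite (ge0_integral_nat (f := fun n => n%:R) P _ (X_measurable k))//.
rewrite -nneseriesZl//; last by move=> n _; rewrite mule_ge0// lee_fin.
apply: eq_eseriesr => r _; rewrite !setTI pE.
transitivity (\int[P]_(w in X k @^-1` [set r]) (S k r w)%:E).
  by apply: eq_integral => w; rewrite inE /= => ->.
by rewrite mean_S -!EFinM; congr (_%:E); ring.
Qed.

(** [D / (1 - b)] is the fixed point of [x = b * x + D], so the means, which start at [0], never
    exceed it. *)
Lemma mean_GW_le N (D b : R) : (0 <= D)%R -> (mu <= b)%R -> (b < 1)%R ->
  (forall k, (k < N)%N -> \int[P]_w (Y k w)%:R%:E <= D%:E) ->
  forall k, (k <= N)%N -> \int[P]_w (X k w)%:R%:E <= (D / (1 - b))%:E.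
Proof.
move=> D0 mub b1 YD.
have mu0 : (0 <= mu)%R.
  by rewrite -lee_fin -mean_xi integral_ge0// => w _; rewrite lee_fin.
have b1' : (0 < 1 - b)%R by rewrite subr_gt0.
have Db : (0 <= D / (1 - b))%R by rewrite divr_ge0// ltW.
elim=> [|k IH] kN.
  case: GW => _ _ _ X0 _.
  by rewrite integral0_eq ?lee_fin// => w _; rewrite X0.
rewrite mean_GW_succ.
apply: (@le_trans _ _ (mu%:E * (D / (1 - b))%:E + D%:E)).
  by rewrite leeD ?YD// lee_wpmul2l ?lee_fin// IH// ltnW.
rewrite -EFinM -EFinD lee_fin.
have {2}-> : (D = (1 - b) * (D / (1 - b)))%R by rewrite mulrCA mulfV ?mulr1// gt_eqF.
by rewrite -mulrDl ler_piMl//; lra.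
Qed.

(** Chebyshev's inequality for the sum of the squared noises, which exceeds [c ^ 2] as soon as one
    noise exceeds [c]. *)
Lemma GW_noise_max_le N (D b c : R) : (0 <= D)%R -> (mu <= b)%R -> (b < 1)%R ->
  (0 < c)%R -> (mu ^+ 2 <= s2)%R ->
  (forall k, (k < N)%N -> \int[P]_w (Y k w)%:R%:E <= D%:E) ->
  P (\bigcup_(k in `I_N) [set w | (c < `|GW_noise k w|)%R]) <=
  (N%:R * (s2 - mu ^+ 2) * (D / (1 - b)) / c ^+ 2)%:E.
Proof.
move=> D0 mub b1 c0 mus2 YD.
set A := \bigcup_(k in _) _.
have mA : measurable A.
  apply: bigcup_measurable => k _.
  rewrite (_ : [set w | _] = (Num.norm \o GW_noise k) @^-1` `]c, +oo[%classic).
    rewrite -[X in measurable X]setTI.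
    by apply: (measurableT_comp (@normr_measurable R setT) (measurable_GW_noise k)) => //.
  by apply/seteqP; split=> w /=; rewrite in_itv/= andbT.
have c2 : (0 < c ^+ 2)%R by rewrite exprn_gt0.
have mN k : measurable_fun setT (fun w => (GW_noise k w ^+ 2)%:E).
  by apply/measurable_EFinP/measurable_funX/measurable_GW_noise.
pose F w := \sum_(k < N) (GW_noise k w ^+ 2)%:E.
have F0 w : 0 <= F w by apply: sume_ge0 => k _; rewrite lee_fin sqr_ge0.
have mF : measurable_fun setT F by apply: emeasurable_sum => k; exact: mN.
have h1 : (c ^+ 2)%:E * P A <= \int[P]_w F w.
  apply: (@le_trans _ _ (\int[P]_(w in A) F w)); last exact: ge0_subset_integral.
  rewrite -(integral_cst P mA); apply: ge0_le_integral => //.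
  - by move=> w _; rewrite lee_fin ltW.
  - exact: measurable_funTS.
  move=> w [k /= kN cN]; rewrite /F (bigD1 (Ordinal kN))//=.
  rewrite -[leLHS]adde0 leeD//.
    by rewrite lee_fin -[leRHS]real_normK ?num_real// ler_pXn2r// ?nnegrE// ltW.
  by apply: sume_ge0 => i _; rewrite lee_fin sqr_ge0.
have h2 : \int[P]_w F w <= (N%:R * (s2 - mu ^+ 2) * (D / (1 - b)))%:E.
  rewrite ge0_integral_sum//; last by move=> k w _; rewrite lee_fin sqr_ge0.
  apply: (@le_trans _ _ (\sum_(k < N) ((s2 - mu ^+ 2) * (D / (1 - b)))%:E)).
    apply: lee_sum => k _; rewrite variance_GW_noise EFinM lee_wpmul2l//.
      by rewrite lee_fin subr_ge0.
    by apply: (mean_GW_le D0 mub b1 YD); exact: ltnW.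
  by rewrite sumEFin sumr_const card_ord -[in leLHS]mulr_natl -[in leRHS]mulrA.
have PAE := fineK (fin_num_measure P _ mA).
rewrite -PAE lee_fin ler_pdivlMr// mulrC -lee_fin (EFinM (c ^+ 2)) PAE.
exact: le_trans h1 h2.
Qed.

End GW_moments.

(** * The perturbed autoregression *)

Section autoregression.
Context {R : realType}.
Implicit Types (alpha a : R) (u e : nat -> R).

Fixpoint autoreg alpha u e (i : nat) : R :=
  if i is j.+1 then alpha * autoreg alpha u e j + u j + e j else 0.

(* The error [autoreg alpha u e i - u i / (1 - a)] solves an autoregression
   whose driving term is small, since [a / (1 - a) + 1 = 1 / (1 - a)]. *)
Lemma autoreg_approx alpha a u e (M theta eta : R) (N : nat) :
  a < 1 -> 0 <= alpha -> `|alpha - a| <= eta -> eta <= (1 - a) / 2 ->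
  0 <= theta -> `|u 0%N| <= eta ->
  (forall i, (i <= N)%N -> `|u i| <= M) ->
  (forall i, (i < N)%N -> `|u i - u i.+1| <= theta) ->
  (forall i, (i < N)%N -> `|e i| <= eta) ->
  let c := (1 - a)^-1 in
  forall i, (i <= N)%N -> `|autoreg alpha u e i - c * u i| <=
    c * eta + 2 * c * (eta * (c * M) + c * theta + eta).
Proof.
move=> a1 alpha0 alphaa etaa theta0 u0 uM uth eeta c.
have c0 : 0 < c by rewrite invr_gt0 subr_gt0.
have ca : c * (1 - a) = 1 by rewrite mulVf// gt_eqF// subr_gt0.
have eta0 : 0 <= eta by exact: le_trans (normr_ge0 _) alphaa.
have M0 : 0 <= M by exact: le_trans (normr_ge0 _) (uM 0%N (leq0n _)).
set kappa := eta * (c * M) + c * theta + eta.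
have kappa0 : 0 <= kappa by rewrite !addr_ge0// !mulr_ge0// ltW.
elim=> [|i IH] iN.
  rewrite sub0r normrN normrM gtr0_norm//.
  apply: (@le_trans _ _ (c * eta)); first by rewrite ler_wpM2l// ltW.
  by rewrite lerDl !mulr_ge0// ltW.
have -> : autoreg alpha u e i.+1 - c * u i.+1 =
    alpha * (autoreg alpha u e i - c * u i) + (alpha - a) * (c * u i) +
    c * (u i - u i.+1) + e i + (1 - c * (1 - a)) * u i by rewrite /=; ring.
rewrite ca subrr mul0r addr0.
have h1 : `|alpha * (autoreg alpha u e i - c * u i)| <=
    alpha * (c * eta + 2 * c * kappa).
  by rewrite normrM ger0_norm// ler_wpM2l// IH// ltnW.
have h2 : `|(alpha - a) * (c * u i)| <= eta * (c * M).
  by rewrite !normrM (gtr0_norm c0) !ler_pM// ?mulr_ge0 ?ler_wpM2l ?uM ?(ltW c0)// ltnW.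
have h3 : `|c * (u i - u i.+1)| <= c * theta.
  by rewrite normrM gtr0_norm// ler_wpM2l ?uth// ltW.
apply: (@le_trans _ _ (alpha * (c * eta + 2 * c * kappa) + kappa)).
  rewrite /kappa !addrA (le_trans (ler_normD _ _))// lerD ?eeta//.
  rewrite (le_trans (ler_normD _ _))// lerD// (le_trans (ler_normD _ _))//.
  by rewrite lerD.
(* As [alpha <= (1 + a) / 2], one has [kappa <= 2 * c * kappa * (1 - alpha)], so the claimed bound
   is preserved by [x] becoming [alpha * x + kappa]. *)
have alpha_le : (1 - a) / 2 <= 1 - alpha.
  by move: alphaa; rewrite ler_norml => /andP[_]; lra.
have h4 : 1 <= 2 * c * (1 - alpha).
  by have := ler_wpM2l (ltW c0) alpha_le; lra.
have h5 : kappa * 1 <= kappa * (2 * c * (1 - alpha)) by rewrite ler_wpM2l.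
have h6 : alpha * (c * eta) <= 1 * (c * eta).
  by rewrite ler_wpM2r ?mulr_ge0 ?(ltW c0)//; lra.
lra.
Qed.

(** The point is uniformity: [eta] and [N] depend on [f], [a], [K] and [eps], but not on [alpha],
    [u] or [e]. *)
Lemma step_autoreg_approx (a K eps : R) (f : Rplus R -> R) :
  0 <= a < 1 -> continuous f -> f (to_Rplus 0) = 0 -> 0 <= K -> 0 < eps ->
  exists eta N, 0 < eta /\ forall n, (N <= n)%N -> forall alpha u e,
    0 <= alpha -> `|alpha - a| <= eta ->
    (forall t, set_val t <= K -> `|step_fun n u t - f t| <= eta) ->
    (forall i, i%:R <= n%:R * K -> `|e i| <= eta) ->
    forall t, set_val t <= K ->
      `|step_fun n (autoreg alpha u e) t - (1 - a)^-1 * f t| <= eps.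
Proof.
move=> /andP[a0 a1] cf f0 K0 eps0; set c := (1 - a)^-1.
have c0 : 0 < c by rewrite invr_gt0 subr_gt0.
have cF : continuous (f \o to_Rplus).
  by move=> x; apply: continuous_comp; [exact: continuous_to_Rplus|exact: cf].
have [M M0 fM] : exists2 M, 0 <= M & forall t, set_val t <= K -> `|f t| <= M.
  have := @segment_compact _ 0 K => /(continuous_compact (continuous_subspaceT cF)).
  move=> /compact_bounded[M [_ hM]]; exists (`|M| + 1); first by rewrite addr_ge0.
  move=> t tK; apply: hM; first by rewrite (le_lt_trans (ler_norm _))// ltrDl.
  exists (set_val t); first by rewrite /= in_itv/= Rplus_ge0.
  by rewrite /= set_valK_Rplus.
(* On the grid [u] is within [eta <= 1] of [f], hence bounded by [M + 1], with increments at most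
   [3 * eta]; [eta * Q] is then the driving term in [autoreg_approx]. The total error is
   [2 * c * Q * eta], plus [c * eta] for the initial value and [c * eta] for replacing [u] by
   [f]. *)
pose Q := c * (M + 1) + 3 * c + 1.
have Q0 : 0 < Q by rewrite /Q; have := mulr_ge0 (ltW c0) M0; lra.
pose eta := Num.min 1 (Num.min ((1 - a) / 2) (eps / (1 + 2 * c + 2 * c * Q))).
have den0 : 0 < 1 + 2 * c + 2 * c * Q.
  by have := mulr_gt0 c0 Q0; lra.
have eta0 : 0 < eta by rewrite !lt_min ltr01 !divr_gt0// subr_gt0.
have [eta1 etaa etaeps] : [/\ eta <= 1, eta <= (1 - a) / 2 &
    eta * (1 + 2 * c + 2 * c * Q) <= eps].
  rewrite -ler_pdivlMr//; split; rewrite /eta !ge_min ?lexx ?orbT//.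
have [r r0 fr] := @continuous_uniform_compact _ _ _ `[0, K] eta cF
  (@segment_compact _ 0 K) eta0.
have [N _ Nr] := near_natinv_le r0.
exists eta, (maxn N 1); split => // n; rewrite geq_max => /andP[Nn n0].
move=> alpha u e alpha0 alphaa uf eeta t tK.
have nR0 : 0 < n%:R :> R by rewrite ltr0n.
pose m := Num.truncn (n%:R * K).
have le_m i : (i <= m)%N = (i%:R <= n%:R * K).
  by rewrite truncn_ge_nat// mulr_ge0.
have uE i : (i <= m)%N -> `|u i - f (to_Rplus (i%:R / n%:R))| <= eta.
  rewrite le_m => iK.
  have := uf (to_Rplus (i%:R / n%:R)); rewrite /step_fun to_RplusK ?divr_ge0//.
  by rewrite mulrCA mulfV ?gt_eqF// mulr1 natrK; apply; rewrite ler_pdivrMr// mulrC.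
have inK i : (i <= m)%N -> i%:R / n%:R <= K.
  by rewrite le_m ler_pdivrMr// mulrC.
have tm : (Num.truncn (n%:R * set_val t) <= m)%N.
  by apply: le_truncn; rewrite ler_wpM2l.
have M1 : forall i, (i <= m)%N -> `|u i| <= M + 1.
  move=> i im; have := fM (to_Rplus (i%:R / n%:R)).
  rewrite to_RplusK ?divr_ge0// => /(_ (inK _ im)) h.
  have := ler_normD (u i - f (to_Rplus (i%:R / n%:R))) (f (to_Rplus (i%:R / n%:R))).
  by rewrite subrK; have := uE i im; lra.
have := @autoreg_approx alpha a u e (M + 1) (3 * eta) eta m a1 alpha0 alphaa etaa _ _ M1.
rewrite mulr_ge0 ?(ltW eta0)//= => /(_ isT) h.
have {h} h : `|autoreg alpha u e (Num.truncn (n%:R * set_val t)) -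
    c * u (Num.truncn (n%:R * set_val t))| <=
    c * eta + 2 * c * (eta * (c * (M + 1)) + c * (3 * eta) + eta).
  apply: h => //.
  (* The autoregression starts at [0]; this is where [f] has to vanish at [0]. *)
  - by have := uE 0%N (leq0n _); rewrite mul0r f0 subr0.
  - move=> i im.
    have h1 := uE i (ltnW im); have h2 := uE i.+1 im.
    have := fr (i%:R / n%:R) (i.+1%:R / n%:R) => /=.
    rewrite in_itv/= divr_ge0//= => /(_ (inK _ (ltnW im))).
    rewrite -mulrBl -natr1 opprD addrA subrr sub0r normrM normrN normr1 mul1r.
    rewrite gtr0_norm ?invr_gt0// => /(_ (Nr _ Nn)); rewrite natr1.
    move: h1 h2; rewrite !ler_norml => /andP[? ?] /andP[? ?] /andP[? ?].
    by apply/andP; split; lra.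
  - by move=> i im; apply: eeta; rewrite -le_m ltnW.
have ut := uf t tK; rewrite /step_fun in ut *.
set j := Num.truncn _ in h ut *.
have -> : autoreg alpha u e j - c * f t =
  (autoreg alpha u e j - c * u j) + c * (u j - f t) by ring.
rewrite (le_trans (ler_normD _ _))//.
have h2 : `|c * (u j - f t)| <= c * eta.
  by rewrite normrM gtr0_norm// ler_wpM2l// ltW.
rewrite /Q in etaeps; lra.
Qed.

End autoregression.

(** * The map sending a path to the pair of itself and its multiple *)

Section linear_embedding.
Context {R : realType}.
Implicit Types (c : R) (f : skorokhod R).

Lemma norm_col2B_le (x y x' y' e : R) : 0 <= e -> `|x - x'| <= e ->
  `|y - y'| <= e -> `|col2 x y - col2 x' y'| <= e.
Proof.
move=> e0 xx yy; rewrite [leLHS]/Num.norm /= mx_normrE; apply/bigmax_leP; split=> //.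
by move=> [i j] _; rewrite !mxE /=; case: ifP.
Qed.

Lemma col2_cadlag c f : cadlag (fun t => col2 (f t) (c * f t)).
Proof.
move=> t; have [ft /cvg_ex[l fl]] := skorokhodP f t; split.
  by apply: cvg_col2 => //; exact: cvgMl_tmp.
apply/cvg_ex; exists (col2 l (c * l)).
by apply: cvg_col2 => //; exact: cvgMl_tmp.
Qed.

Definition col2_path c f : skorokhod 'cV[R]_2 := Skorokhod (col2_cadlag c f).

(** The time changes for [f] serve for the pair as well; [r] is such that both [r] and [|c| * r] are
    at most [e]. *)
Lemma continuous_col2_path c : continuous (col2_path c).
Proof.
apply: J1_continuous => f_ f /J1_cvgP[lam tc h].
apply/J1_cvg_nbhs/J1_cvgP; exists lam => // e K e0 K0.
pose r := e / (1 + `|c|).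
have c0 : 0 < 1 + `|c| by rewrite ltr_pwDl.
have r0 : 0 < r by rewrite divr_gt0.
have er : e = r * (1 + `|c|) by rewrite mulfVK// gt_eqF.
have re : r <= e by rewrite er ler_pMr// lerDl.
apply: filterS (h r K r0 K0) => n [h1 h2]; split=> t.
  exact: le_trans (h1 t) re.
move=> tK; apply: norm_col2B_le; first exact: ltW.
  exact: le_trans (h2 t tK) re.
rewrite -mulrBr normrM er mulrC ler_pM// ?h2// lerDr//.
Qed.

End linear_embedding.

(** * Paths that a small noise can make bad *)

Section bad_paths.
Context {R : realType}.
Variables (h : skorokhod 'cV[R]_2 -> R) (a : R) (alpha : nat -> R) (eps : R).
Hypotheses (ch : continuous h) (a01 : 0 <= a < 1) (eps0 : 0 < eps).
Hypotheses (alpha_ge0 : forall n, 0 <= alpha n) (alpha_cvg : alpha @ \oo --> a).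

(** The index [k] bounds [n] from below, the noise by [1 / (k + 1)], and sets the horizon [k + 1] up
    to which the noise is controlled. The sets therefore decrease, and any fixed tolerance and
    horizon are eventually covered. *)
Definition bad_path (k : nat) : set (skorokhod R) := [set f |
  exists n (u e : nat -> R), [/\ (k <= n)%N, f = step_path n u,
    forall i, (i < n * k.+1)%N -> `|e i| <= k.+1%:R^-1 &
    eps < `|h (step_path n (fun i => col2 (u i) (autoreg (alpha n) u e i))) -
            h (col2_path (1 - a)^-1 f)|]].

Lemma bad_path_nonincreasing k k' : (k <= k')%N -> bad_path k' `<=` bad_path k.
Proof.
move=> kk' f [n [u [e [k'n fu ek' hf]]]]; exists n, u, e; split => //.
  exact: leq_trans k'n.
move=> i ik; apply: le_trans (ek' i _) _.
  by apply: leq_trans ik _; rewrite leq_mul2l ltnS kk' orbT.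
by rewrite lef_pV2 ?posrE ?ltr0n// ler_nat ltnS.
Qed.

(** Otherwise bad paths [G k] converge to [f] locally uniformly. By [step_autoreg_approx] the
    perturbed pairs converge to [(f, f / (1 - a))], and so do the pairs built from [G k]; [h] then
    has the same limit along both, against the gap [eps]. *)
Lemma bad_path_far (f : skorokhod R) : continuous f -> f (to_Rplus 0) = 0 ->
  exists k0, forall g, bad_path k0 g -> k0.+1%:R^-1 <= graph_dist g f.
Proof.
move=> cf f0; apply: contrapT => /forallNP far.
have /choice[G GP] k : exists g, bad_path k g /\ graph_dist g f < k.+1%:R^-1.
  apply: contrapT => /forallNP ng; apply: (far k) => g bg.
  by rewrite leNgt; apply/negP => gf; apply: (ng g).
have /choice[n nP] k : exists n, exists u e, [/\ (k <= n)%N, G k = step_path n u,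
    forall i, (i < n * k.+1)%N -> `|e i| <= k.+1%:R^-1 &
    eps < `|h (step_path n (fun i => col2 (u i) (autoreg (alpha n) u e i))) -
            h (col2_path (1 - a)^-1 (G k))|] by exact: (GP k).1.
have /choice[u uP] := nP.
have /choice[e eP] := uP.
have Gf : forall r K, 0 < r -> 0 < K -> \forall k \near \oo,
    forall t, set_val t <= K -> `|G k t - f t| <= r.
  move=> r K r0 K0.
  have [q q0 hq] := @graph_dist_unif _ _ f K r cf (ltW K0) r0.
  have := near_infty_natSinv_lt (PosNum q0).
  by apply: filterS => k kq; apply: hq; rewrite (lt_trans (GP k).2).
have c1 : h (col2_path (1 - a)^-1 (G k)) @[k --> \oo] -->
    h (col2_path (1 - a)^-1 f).
  apply: (@continuous_J1 _ _ _ (h \o col2_path (1 - a)^-1)).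
    move=> z; apply: continuous_comp; first exact: continuous_col2_path.
    exact: ch.
  exact: unif_J1_cvg.
have c2 : h (step_path (n k) (fun i => col2 (u k i) (autoreg (alpha (n k)) (u k) (e k) i)))
    @[k --> \oo] --> h (col2_path (1 - a)^-1 f).
  apply: continuous_J1 => //; apply: unif_J1_cvg => r K r0 K0.
  have [eta [N [eta0 hN]]] := step_autoreg_approx a01 cf f0 (ltW K0) r0.
  have [N' _ hN'] : \forall n \near \oo, `|alpha n - a| <= eta.
    by move/cvgrPdist_le : alpha_cvg => /(_ _ eta0); apply: filterS => ?; rewrite distrC.
  near=> k => t tK.
  have [kn Gu ek _] := eP k.
  have Nk : (N <= n k)%N by rewrite (leq_trans _ kn)//; near: k; exists N.
  have N'k : (N' <= n k)%N by rewrite (leq_trans _ kn)//; near: k; exists N'.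
  have k1 : k.+1%:R^-1 <= eta.
    near: k; have := near_infty_natSinv_lt (PosNum eta0).
    by apply: filterS => k /ltW.
  have Kk : K <= k%:R by near: k; exact: nbhs_infty_ger.
  have k0 : (0 < k)%N by near: k; exists 1%N.
  (* The bound [r] is for the first coordinate, the bound [eta] feeds the autoregression
     estimate. *)
  have uf s : set_val s <= K -> `|step_fun (n k) (u k) s - f s| <= Num.min eta r.
    have : forall s, set_val s <= K -> `|G k s - f s| <= Num.min eta r.
      by near: k; apply: Gf => //; rewrite lt_min eta0.
    by rewrite Gu; exact.
  have := hN _ Nk (alpha (n k)) (u k) (e k) (alpha_ge0 _) (hN' _ N'k) _ _ t tK.
  move=> hh; apply: norm_col2B_le; first exact: ltW.
    by apply: le_trans (uf t tK) _; rewrite ge_min lexx orbT.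
  apply: hh.
    by move=> s sK; apply: le_trans (uf s sK) _; rewrite ge_min lexx.
  move=> i iK; apply: le_trans (ek i _) k1.
  have : i%:R <= (n k * k)%:R :> R.
    by rewrite natrM (le_trans iK)// ler_wpM2l.
  rewrite ler_nat => /leq_ltn_trans; apply.
  by rewrite ltn_mul2l ltnSn andbT (leq_trans k0).
have : \forall k \near \oo, `|h (step_path (n k)
    (fun i => col2 (u k i) (autoreg (alpha (n k)) (u k) (e k) i))) -
    h (col2_path (1 - a)^-1 (G k))| <= eps.
  move/cvgrPdist_le : c1 => /(_ (eps / 2)); rewrite divr_gt0// => /(_ isT) c1.
  move/cvgrPdist_le : c2 => /(_ (eps / 2)); rewrite divr_gt0// => /(_ isT).
  apply: filterS2 c1 => k; rewrite !ler_norml => /andP[? ?] /andP[? ?].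
  by apply/andP; split; lra.
move=> [N _ /(_ N (leqnn _))].
by have [_ _ _] := eP N; rewrite ltNge => /negP.
Unshelve. all: by end_near. Qed.

(** The cutoffs vanish from rank [k0] on: the sets decrease, so the distance [1 / (k0 + 1)]
    persists, and the cutoff of slope [k + 1] vanishes at distance [1 / (k + 1)]. *)
Lemma cutoff_bad_path_cvg0 (f : skorokhod R) : continuous f ->
  f (to_Rplus 0) = 0 -> cutoff k.+1 (bad_path k) f @[k --> \oo] --> 0.
Proof.
move=> cf f0; have [k0 hk0] := bad_path_far cf f0.
apply: cvg_near_cst; exists k0 => // k /= k0k; apply: cutoff_eq0 => // g.
move=> /(bad_path_nonincreasing k0k)/hk0; apply: le_trans.
by rewrite lef_pV2 ?posrE ?ltr0n// ler_nat ltnS.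
Qed.

End bad_paths.

(** * Weak convergence *)

Section bounded_expectation.
Context d (T : measurableType d) {R : realType} (P : probability T R).

Lemma bounded_RV_integrable (F : T -> R) (M : R) :
  measurable_fun setT F -> (forall w, `|F w| <= M) ->
  P.-integrable setT (EFin \o F).
Proof.
move=> mF FM; apply: measurable_bounded_integrable => //.
  exact: (le_lt_trans (probability_le1 P measurableT) (ltry 1)).
exists M; split; rewrite ?num_real// => x Mx w _ /=.
by rewrite (le_trans (FM w))// ltW.
Qed.

Lemma integral_pushforward_bounded (E : ptopologicalType) (Z : T -> E)
    (h : E -> R) (M : R) : measurable_fun setT (Z : T -> borel E) ->
  continuous h -> (forall x, `|h x| <= M) ->
  (\int[pushforward P (Z : T -> borel E)]_x (h x)%:E)%E =
  (\int[P]_w h (Z w))%:E.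
Proof.
move=> mZ ch hM.
have mh := borel_measurable_continuous ch.
have ihZ : P.-integrable setT (EFin \o (h \o Z)).
  apply: (@bounded_RV_integrable _ M) => [|w]; last exact: hM.
  exact: (measurableT_comp mh mZ).
rewrite (integral_pushforward (phi := (Z : T -> borel E)) mZ (D := setT)
  (f := EFin \o h))//; last first.
  exact/measurable_EFinP.
by rewrite preimage_setT /Rintegral fineK//; exact: integrable_fin_num.
Qed.

(** The bad event enters through its majorant [C] and not as a set, so its measurability is not at
    issue; [A] will be the event of large noise. *)
Lemma dist_Rintegral_le (F G C : T -> R) (A : set T) (M eps : R) :
  measurable_fun setT F -> measurable_fun setT G -> measurable_fun setT C ->
  measurable A -> 0 <= M ->
  (forall w, `|F w| <= M) -> (forall w, `|G w| <= M) ->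
  (forall w, 0 <= C w <= 1) ->
  (forall w, ~ A w -> `|F w - G w| <= eps + 2 * M * C w) ->
  0 <= eps ->
  `|\int[P]_w F w - \int[P]_w G w| <=
    eps + 2 * M * \int[P]_w C w + 2 * M * fine (P A).
Proof.
move=> mF mG mC mA M0 FM GM C01 FG eps0.
have iF := bounded_RV_integrable mF FM.
have iG := bounded_RV_integrable mG GM.
have iC : P.-integrable setT (EFin \o C).
  apply: (@bounded_RV_integrable _ 1) => // w.
  by have /andP[? ?] := C01 w; rewrite ger0_norm.
have FGM w : `|F w - G w| <= 2 * M.
  by have := ler_normB (F w) (G w); have := FM w; have := GM w; lra.
have mFG : measurable_fun setT (fun w => F w - G w) by exact: measurable_funB.
have iFG := bounded_RV_integrable mFG FGM.
have iFG' : P.-integrable setT (EFin \o (fun w => `|F w - G w|)).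
  apply: (@bounded_RV_integrable _ (2 * M)); last by move=> w; rewrite normr_id.
  exact: measurableT_comp.
have iA : P.-integrable setT (EFin \o (\1_A : T -> R)).
  apply: (@bounded_RV_integrable _ 1); first exact: measurable_indic.
  by move=> w; rewrite indicE; case: (w \in A); rewrite ?normr1 ?normr0.
have icst x : P.-integrable setT (EFin \o (fun _ : T => x : R)).
  exact: (finite_measure_integrable_cst P x).
rewrite -RintegralB//.
have i2C : P.-integrable setT (EFin \o (fun w => 2 * M * C w)).
  apply: (@bounded_RV_integrable _ (2 * M)).
    by apply: measurable_funM => //; exact: measurable_cst.
  move=> w; have /andP[? ?] := C01 w.
  by rewrite ger0_norm ?ler_piMr ?mulr_ge0.
have i2A : P.-integrable setT (EFin \o (fun w => 2 * M * \1_A w)).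
  apply: (@bounded_RV_integrable _ (2 * M)).
    by apply: measurable_funM; [exact: measurable_cst|exact: measurable_indic].
  move=> w; rewrite indicE; case: (w \in A).
    by rewrite mulr1 ger0_norm// mulr_ge0.
  by rewrite mulr0 normr0 mulr_ge0.
have i1 : P.-integrable setT (EFin \o (fun w => eps + 2 * M * C w)).
  apply: (@bounded_RV_integrable _ (eps + 2 * M)).
    apply: measurable_funD; first exact: measurable_cst.
    by apply: measurable_funM => //; exact: measurable_cst.
  move=> w; have /andP[? ?] := C01 w.
  by rewrite ger0_norm ?addr_ge0 ?mulr_ge0// lerD2l ler_piMr ?mulr_ge0.
have i12 : P.-integrable setT
    (EFin \o (fun w => eps + 2 * M * C w + 2 * M * \1_A w)).
  have := integrableD measurableT i1 i2A; apply: eq_integrable => // w _.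
apply: (le_trans (le_normr_Rintegral measurableT iFG)).
apply: (@le_trans _ _ (\int[P]_w (eps + 2 * M * C w + 2 * M * \1_A w))).
  apply: le_Rintegral => // w _; rewrite indicE.
  have /andP[? ?] := C01 w.
  have [wA|wA] := boolP (w \in A).
    by rewrite mulr1 (le_trans (FGM w))// lerDr addr_ge0// !mulr_ge0.
  by rewrite mulr0 addr0; apply: FG; move: wA; rewrite notin_setE.
have epsE : \int[P]_w eps = eps.
  rewrite Rintegral_cst// -[RHS]mulr1; congr (_ * _).
  exact: (congr1 fine (probability_setT P)).
have AE : \int[P]_w (\1_A w : R) = fine (P A).
  by rewrite /Rintegral integral_indic// setIT.
by rewrite RintegralD// RintegralD// !RintegralZl// epsE AE.
Qed.

End bounded_expectation.

(** * The rescaled process and its noise *)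

Section scaled_GW.
Context d (T : measurableType d) (R : realType) (P : probability T R).
Variables (m : nat -> R) (xi : nat -> nat -> nat -> {RV P >-> nat}).
Variables (Y : nat -> nat -> {RV P >-> nat}) (X : nat -> nat -> T -> nat).
Hypothesis m_gt0 : forall n, (0 < n)%N -> 0 < m n.
Hypothesis XGW : forall n, (0 < n)%N -> GW_immigration (xi n) (Y n) (X n).
Hypothesis Exi_fin : forall n, (0 < n)%N ->
  ('E_P[fun w => (xi n 1%N 1%N w)%:R%R] < +oo)%E.
Hypothesis Exi2_fin : forall n, (0 < n)%N ->
  ('E_P[fun w => ((xi n 1%N 1%N w)%:R ^+ 2)%R] < +oo)%E.

Definition offspring_mean n := fine ('E_P[fun w => ((xi n 1%N 1%N w)%:R)%R])%E.

Definition offspring_moment2 n := fine ('E_P[fun w => ((xi n 1%N 1%N w)%:R ^+ 2)%R])%E.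

Lemma offspring_mean_ge0 n : 0 <= offspring_mean n.
Proof.
rewrite fine_ge0// unlock integral_ge0// => w _; rewrite lee_fin//.
Qed.

Lemma offspring_meanE n : (0 < n)%N ->
  (\int[P]_w (xi n 1 1 w)%:R%:E = (offspring_mean n)%:E)%E.
Proof.
move=> n0; transitivity ('E_P[fun w => ((xi n 1%N 1%N w)%:R)%R])%E; first by rewrite unlock.
rewrite fineK// ge0_fin_numE ?Exi_fin//.
by rewrite unlock integral_ge0// => w _; rewrite lee_fin.
Qed.

Lemma offspring_moment2E n : (0 < n)%N ->
  (\int[P]_w ((xi n 1 1 w)%:R ^+ 2)%:E = (offspring_moment2 n)%:E)%E.
Proof.
move=> n0; transitivity ('E_P[fun w => ((xi n 1%N 1%N w)%:R ^+ 2)%R])%E; first by rewrite unlock.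
rewrite fineK// ge0_fin_numE ?Exi2_fin//.
by rewrite unlock integral_ge0// => w _; rewrite lee_fin sqr_ge0.
Qed.

Lemma offspring_varianceE n : (0 < n)%N ->
  'V_P[fun w => (xi n 1%N 1%N w)%:R] =
  (offspring_moment2 n - offspring_mean n ^+ 2)%:E.
Proof.
move=> n0; rewrite /variance !unlock.
transitivity (\int[P]_w (((xi n 1 1 w)%:R - offspring_mean n) ^+ 2)%:E)%E.
  by apply: eq_integral => w _; rewrite /offspring_mean unlock expr2.
rewrite (integral_sqr_center (p := 1) measurableT _ _ (offspring_mean_ge0 n) _
  (offspring_meanE n0) (offspring_moment2E n0)).
- by congr (_%:E); ring.
- apply: (@measurable_fun_countable _ _ _ _ nat (xi n 1 1)
    (fun n => n%:R : R)) => x.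
  by rewrite -[X in measurable X]setTI; exact: (measurable_funPT (xi n 1 1)).
- by [].
- exact: probability_setT.
Qed.

Lemma offspring_variance_ge0 n : (0 < n)%N ->
  offspring_mean n ^+ 2 <= offspring_moment2 n.
Proof.
move=> n0; rewrite -subr_ge0 -lee_fin -offspring_varianceE//.
exact: variance_ge0.
Qed.

Let noise n := GW_noise (Y n) (X n) (offspring_mean n).

Lemma scaled_GW_autoreg n k w : (0 < n)%N ->
  (m n)^-1 * (X n k w)%:R = autoreg (offspring_mean n)
    (fun i => (m n)^-1 * (Y n i w)%:R) (fun i => (m n)^-1 * noise n i w) k.
Proof.
move=> n0; elim: k => [|k IH] /=.
  by case: (XGW n0) => _ _ _ -> _; rewrite mulr0.
by rewrite -IH /noise /GW_noise; ring.
Qed.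

(** For [q = k + 1], the noise divided by [m n] satisfies, off this event, the requirement in
    [bad_path k]. *)
Definition large_noise (q n : nat) : set T :=
  \bigcup_(i in `I_(n * q)) [set w | m n / q%:R < `|noise n i w|].

Lemma measurable_large_noise q n : (0 < n)%N -> measurable (large_noise q n).
Proof.
move=> n0; apply: bigcup_measurable => i _.
rewrite (_ : [set w | _] = (Num.norm \o noise n i) @^-1` `](m n / q%:R), +oo[%classic).
  rewrite -[X in measurable X]setTI.
  by apply: (measurableT_comp (@normr_measurable R setT)
    (measurable_GW_noise (XGW n0) _ i)) => //.
by apply/seteqP; split=> w /=; rewrite in_itv/= andbT.
Qed.

(** The bound of [GW_noise_max_le] equals [q ^ 3 * D / (1 - b)] times [n / m n] times the offspring
    variance: one factor [q] comes from the number of noises and two from the threshold. *)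
Lemma large_noise_cvg0 (a : R) (q : nat) : a < 1 -> (0 < q)%N ->
  (exists L : skorokhod R, forall t : Rplus R,
      (limn_esup (fun n => ereal_sup
        [set 'E_P[fun w =>
            ((m n)^-1 * (Y n (Num.truncn (n%:R * set_val s)) w)%:R)%R]
          | s in [set s : Rplus R | (set_val s <= set_val t)%R]])
       <= (L t)%:E)%E) ->
  (((m n)^-1 * n%:R)%R%:E * 'V_P[fun w => (xi n 1%N 1%N w)%:R%R])%E
    @[n --> \oo] --> 0%E ->
  offspring_mean @ \oo --> a ->
  fine (P (large_noise q n)) @[n --> \oo] --> 0.
Proof.
move=> a1 q0 [L EYL] Vcvg mucvg.
have q0R : 0 < q%:R :> R by rewrite ltr0n.
(* The [+ 1] makes the bound on the limit superior strict, so that it holds for the suprema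
   themselves from some rank on. *)
pose D := `|L (to_Rplus q%:R)| + 1.
have D0 : 0 <= D by rewrite addr_ge0.
pose b := (1 + a) / 2.
have b1 : b < 1 by rewrite /b; lra.
have bE : \forall n \near \oo, offspring_mean n <= b.
  by apply: cvgr_le mucvg _ _; rewrite /b; lra.
have EYb : \forall n \near \oo, forall i, (i < n * q)%N ->
    (\int[P]_w (Y n i w)%:R%:E <= (D * m n)%:E)%E.
  have : (limn_esup (fun n => ereal_sup
        [set 'E_P[fun w =>
            ((m n)^-1 * (Y n (Num.truncn (n%:R * set_val s)) w)%:R)%R]
          | s in [set s : Rplus R | (set_val s <= set_val (to_Rplus q%:R))%R]])
       < D%:E)%E.
    apply: le_lt_trans (EYL (to_Rplus q%:R)) _.
    by rewrite lte_fin /D (le_lt_trans (ler_norm _))// ltrDl.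
  rewrite /limn_esup limf_esupE => /ereal_inf_lt[_ [V Vn <-] VD].
  have : \forall n \near \oo, V n /\ (0 < n)%N.
    by apply: filterI => //; exists 1%N.
  apply: filterS => n [nV n0] i inq.
  have nR0 : 0 < n%:R :> R by rewrite ltr0n.
  have h : ('E_P[fun w => ((m n)^-1 * (Y n i w)%:R)%R] <= D%:E)%E.
    apply: le_trans (ltW VD); apply: le_trans; last first.
      by apply: ereal_sup_ubound; exists n; first exact: nV.
    apply: ereal_sup_ubound; exists (to_Rplus (i%:R / n%:R)) => /=.
      rewrite !to_RplusK ?divr_ge0//.
      by rewrite ler_pdivrMr// -natrM ler_nat mulnC ltnW.
    by rewrite to_RplusK ?divr_ge0// mulrCA mulfV ?gt_eqF// mulr1 natrK.
  move: h; rewrite unlock.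
  under eq_integral do rewrite EFinM.
  rewrite ge0_integralZl_EFin//; last 2 first.
  - apply/measurable_EFinP.
    apply: (@measurable_fun_countable _ _ _ _ nat (Y n i) (fun n => n%:R : R)) => x.
    by rewrite -[X in measurable X]setTI; exact: (measurable_funPT (Y n i)).
  - by rewrite invr_ge0 ltW// m_gt0.
  by rewrite muleC -lee_pdivlMr ?invr_gt0 ?m_gt0// invrK -EFinM.
have [/= vfin vcvg] := (fine_cvgP _ _).1 Vcvg.
pose v n := (m n)^-1 * n%:R * (offspring_moment2 n - offspring_mean n ^+ 2).
have {}vcvg : v @ \oo --> 0.
  apply: cvg_trans vcvg; apply: near_eq_cvg.
  by exists 1%N => // n /= n0; rewrite offspring_varianceE.
pose cc := q%:R ^+ 3 * D / (1 - b).
have cvcvg : cc * v n @[n --> \oo] --> 0.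
  by rewrite -(mulr0 cc); exact: cvgMl_tmp.
apply: (@squeeze_cvgr _ _ _ _ (fun=> 0) (fun n => cc * v n)) => //; last exact: cvg_cst.
near=> n; rewrite fine_ge0//=.
have n0 : (0 < n)%N by near: n; exists 1%N.
have mn0 := m_gt0 n0.
rewrite -lee_fin fineK; last by apply: fin_num_measure; exact: measurable_large_noise.
have mub : offspring_mean n <= b by near: n.
have YD : forall i, (i < n * q)%N ->
  (\int[P]_w (Y n i w)%:R%:E <= (D * m n)%:E)%E by near: n.
have Dm0 : 0 <= D * m n by rewrite mulr_ge0// ltW.
have mq0 : 0 < m n / q%:R by rewrite divr_gt0.
apply: le_trans (GW_noise_max_le (XGW n0) (offspring_meanE n0)
  (offspring_moment2E n0) Dm0 mub b1 mq0 (offspring_variance_ge0 n0) YD) _.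
rewrite lee_fin le_eqVlt; apply/orP; left; apply/eqP.
have [mne qne] : m n != 0 /\ q%:R != 0 :> R by rewrite !gt_eqF.
have bne : 1 - b != 0 by rewrite gt_eqF// subr_gt0.
by rewrite /cc /v natrM; field; rewrite mne qne bne.
Unshelve. all: by end_near. Qed.

End scaled_GW.

(** * Passage to the limit for the pair *)

Lemma skorokhod_inj (R : realType) (V : normedModType R) (f g : skorokhod V) :
  f =1 g -> f = g.
Proof.
case: f g => [f cf] [g cg] /= /funext fg; rewrite fg in cf *.
by congr Skorokhod; exact: Prop_irrelevance.
Qed.

Lemma borel_measurable_map (E E' : ptopologicalType) (F : E -> E') :
  continuous F -> measurable_fun setT (F : borel E -> borel E').
Proof.
move=> /continuousP cF; apply: (@measurability _ _ (borel E) (borel E') setT F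
  (@open E')) => // _ [U oU <-].
by rewrite setTI; apply: sub_sigma_algebra; exact: cF.
Qed.

Lemma cvg_EFin_real (R : realType) (u : nat -> R) (l : R) :
  (u n)%:E @[n --> \oo] --> l%:E -> u @ \oo --> l.
Proof. by move=> /fine_cvgP[]. Qed.

Theorem theorem3p1 (d : measure_display) (T : measurableType d) (R : realType)
    (P : probability T R)
    (m : nat -> R)
    (m_gt0 : forall n, (0 < n)%N -> 0 < m n)
    (xi : nat -> nat -> nat -> {RV P >-> nat})
    (Y : nat -> nat -> {RV P >-> nat})
    (X : nat -> nat -> T -> nat)
    (XGW : forall n, (0 < n)%N -> GW_immigration (xi n) (Y n) (X n))
    (Exi_fin : forall n, (0 < n)%N ->
      ('E_P[fun w => (xi n 1%N 1%N w)%:R%R] < +oo)%E)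
    (EY_fin : forall n k, (0 < n)%N -> ('E_P[fun w => (Y n k w)%:R%R] < +oo)%E)
    (EY_bound : exists L : skorokhod R, forall t : Rplus R,
      (limn_esup (fun n => ereal_sup
        [set 'E_P[fun w =>
            ((m n)^-1 * (Y n (Num.truncn (n%:R * set_val s)) w)%:R)%R]
          | s in [set s : Rplus R | (set_val s <= set_val t)%R]])
       <= (L t)%:E)%E)
    (Ylim : Rplus R -> {RV P >-> R})
    (Ylim_ge0 : forall t w, 0 <= Ylim t w)
    (Ylim_cont : forall w, continuous (fun t : Rplus R => Ylim t w))
    (Ylim0 : forall t w, set_val t = 0 -> Ylim t w = 0)
    (Y_cvg : cvg_in_distribution P
      (fun n w => step_path n (fun k => (m n)^-1 * (Y n k w)%:R))
      (fun w => continuous_path (Ylim_cont w)))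
    (Exi2_fin : forall n, (0 < n)%N ->
      ('E_P[fun w => ((xi n 1%N 1%N w)%:R ^+ 2)%R] < +oo)%E)
    (Vxi_cvg :
      (((m n)^-1 * n%:R)%R%:E * 'V_P[fun w => (xi n 1%N 1%N w)%:R%R])%E
        @[n --> \oo] --> 0%E)
    (a : R) (a_ge0 : 0 <= a) (a_lt1 : a < 1)
    (Exi_cvg : 'E_P[fun w => (xi n 1%N 1%N w)%:R%R]%E @[n --> \oo] --> a%:E) :
  cvg_in_distribution P
    (fun n w => step_path n
      (fun k => (m n)^-1 *: col2 (Y n k w)%:R (X n k w)%:R))
    (fun w => continuous_path
      (f := fun t : Rplus R => col2 (Ylim t w) ((1 - a)^-1 * Ylim t w))
      (continuous_col2 (Ylim_cont w) (continuous_cmul (Ylim_cont w)))).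
Proof.
rewrite /cvg_in_distribution => h ch [M0 hM0].
have a01 : 0 <= a < 1 by rewrite a_ge0.
pose c := (1 - a)^-1.
pose M := `|M0|.
have M_ge0 : 0 <= M by exact: normr_ge0.
have hM x : `|h x| <= M by exact: le_trans (hM0 x) (ler_norm _).
pose Yp n w := step_path n (fun k => (m n)^-1 * (Y n k w)%:R).
pose Yl w := continuous_path (Ylim_cont w).
have rvY n k x : measurable (Y n k @^-1` [set x]).
  by rewrite -[X in measurable X]setTI; exact: (measurable_funPT (Y n k)).
have mYp n : measurable_fun setT (Yp n : T -> borel (skorokhod R)).
  exact: (@measurable_step_path R R _ _ nat n (Y n) (fun _ j => (m n)^-1 * j%:R)).
have mYl : measurable_fun setT (Yl : T -> borel (skorokhod R)).
  apply: measurable_continuous_path => //.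
have Ycvg (g : skorokhod R -> R) (B : R) : continuous g -> (forall x, `|g x| <= B) ->
    \int[P]_w g (Yp n w) @[n --> \oo] --> \int[P]_w g (Yl w).
  move=> cg gB; apply: cvg_EFin_real.
  have := Y_cvg g cg (ex_intro _ B gB).
  rewrite (integral_pushforward_bounded (M := B) P mYl cg gB).
  apply: cvg_trans; apply: near_eq_cvg; apply: nearW => n.
  by rewrite (integral_pushforward_bounded (M := B) P (mYp n) cg gB).
pose hc := h \o col2_path c.
have chc : continuous hc.
  by move=> f; apply: continuous_comp; [exact: continuous_col2_path|exact: ch].
pose Zn n w := step_path n (fun k => (m n)^-1 *: col2 (Y n k w)%:R (X n k w)%:R).
pose Z w := continuous_path (f := fun t : Rplus R => col2 (Ylim t w) (c * Ylim t w))
  (continuous_col2 (Ylim_cont w) (continuous_cmul (Ylim_cont w))).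
change ((\int[pushforward P (Zn n : T -> borel (skorokhod 'cV[R]_2))]_x (h x)%:E)%E
  @[n --> \oo] -->
  (\int[pushforward P (Z : T -> borel (skorokhod 'cV[R]_2))]_x (h x)%:E)%E).
have ZE w : Z w = col2_path c (Yl w) by exact: skorokhod_inj.
have ZnE n w : Zn n w = step_path n (fun k =>
    col2 ((m n)^-1 * (Y n k w)%:R) ((m n)^-1 * (X n k w)%:R)).
  apply: skorokhod_inj => t; rewrite /= /step_fun.
  by apply/matrixP => i j; rewrite !mxE; case: ifP.
have mZ : measurable_fun setT (Z : T -> borel (skorokhod 'cV[R]_2)).
  rewrite (_ : Z = col2_path c \o Yl); last by apply/funext.
  exact: (measurableT_comp (borel_measurable_map (@continuous_col2_path R c)) mYl).
have mZn n : (0 < n)%N -> measurable_fun setT (Zn n : T -> borel (skorokhod 'cV[R]_2)).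
  move=> n0.
  apply: (@measurable_step_path R _ _ _ (nat * nat)%type n
    (fun k w => (Y n k w, X n k w))
    (fun _ yx => (m n)^-1 *: col2 yx.1%:R yx.2%:R)) => k [y x].
  rewrite (_ : _ @^-1` _ = Y n k @^-1` [set y] `&` X n k @^-1` [set x]).
    by apply: measurableI => //; exact: (GW_measurable (XGW n n0)).
  by apply/seteqP; split=> w /= [-> ->].
have mucvg : offspring_mean xi @ \oo --> a by exact: fine_cvg Exi_cvg.
have mh := borel_measurable_continuous ch.
have mhc := borel_measurable_continuous chc.
(* As [hc] is itself bounded and continuous on paths, [Y_cvg] settles the limit of the integrals of
   [hc (Yp n w)]; only this difference has to be made small. *)
have main (delta : R) : 0 < delta -> \forall n \near \oo,
    `|\int[P]_w h (Zn n w) - \int[P]_w hc (Yp n w)| <= delta.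
  move=> delta0.
  pose eps := delta / 4.
  have eps0 : 0 < eps by rewrite divr_gt0.
  pose B := bad_path h a (offspring_mean xi) eps.
  have cutM k f : `|cutoff k.+1 (B k) f| <= 1.
    by rewrite ger0_norm ?cutoff_ge0 ?cutoff_le1.
  have ccut k := @cutoff_continuous R R k.+1 (B k).
  have mcut k := borel_measurable_continuous (ccut k).
  (* Every limit path is continuous and starts at [0], so the cutoffs tend to [0] pointwise;
     dominated convergence applies with the constant [1]. *)
  have cut0 : \int[P]_w cutoff k.+1 (B k) (Yl w) @[k --> \oo] --> 0.
    apply: cvg_EFin_real.
    pose f_ k w := (cutoff k.+1 (B k) (Yl w))%:E.
    have mf k : measurable_fun setT (f_ k).
      apply/measurable_EFinP.
      exact: (measurableT_comp (mcut k) mYl).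
    have fcvg : {ae P, forall w, setT w -> f_ k w @[k --> \oo] --> cst 0%E w}.
      apply: aeW => w _; apply: cvg_EFin; first exact: nearW.
      apply: (cutoff_bad_path_cvg0 ch a01 eps0 (offspring_mean_ge0 xi) mucvg).
        exact: Ylim_cont.
      by apply: Ylim0; rewrite to_RplusK.
    have i1 : P.-integrable setT (cst 1%E : T -> \bar R).
      exact: (finite_measure_integrable_cst P 1).
    have f1 : {ae P, forall w n, setT w -> (`|f_ n w| <= cst 1%E w)%E}.
      by apply: aeW => w n _; rewrite lee_fin; exact: cutM.
    have [_ _] := dominated_convergence measurableT mf (measurable_cst _) fcvg i1 f1.
    rewrite integral0; apply: cvg_trans; apply: near_eq_cvg; apply: nearW => k.
    rewrite /Rintegral fineK//; apply: integrable_fin_num => //.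
    apply: (@bounded_RV_integrable _ _ _ _ _ 1) => [|w]; last exact: cutM.
    exact: (measurableT_comp (mcut k) mYl).
  have M21 : 0 < 2 * M + 1 by rewrite ltr_wpDl// mulr_ge0.
  (* [2 * M * x] is at most [delta / 4]. The budget is one such quarter for [eps], two for the
     cutoff and one for the large noise; the [+ 1] covers [M = 0]. *)
  pose x := delta / 4 / (2 * M + 1).
  have d4 : 0 < x by rewrite !divr_gt0.
  have xE : (2 * M + 1) * x = delta / 4 by rewrite mulrC mulfVK// gt_eqF.
  have arith y z : y <= 2 * M * (2 * x) -> z <= 2 * M * x -> eps + y + z <= delta.
    by rewrite /eps; lra.
  (* [k] is fixed before [n], so weak convergence is used for this single cutoff; going from [x] to
     [2 * x] leaves the room needed in that limit. *)
  have [k cutk] : exists k, \int[P]_w cutoff k.+1 (B k) (Yl w) <= x.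
    have [k _ /(_ k (leqnn _)) hk] := (cvgr_le _ cut0 _ d4).
    by exists k.
  have noise0 := large_noise_cvg0 m_gt0 XGW Exi_fin Exi2_fin a_lt1 (ltn0Sn k)
    EY_bound Vxi_cvg mucvg.
  have Ycvgk := Ycvg _ _ (ccut k) (cutM k).
  near=> n.
  have n0 : (0 < n)%N by near: n; exists 1%N.
  have kn : (k <= n)%N by near: n; exists k.
  have mn0 := m_gt0 n n0.
  have noisen : fine (P (large_noise m xi Y X k.+1 n)) <= x.
    by near: n; exact: cvgr_le _ noise0 _ d4.
  have cutn : \int[P]_w cutoff k.+1 (B k) (Yp n w) <= 2 * x.
    near: n; apply: cvgr_le _ Ycvgk _ _.
    by rewrite (le_lt_trans cutk)// ltr_pMl// ltr1n.
  have bound := @dist_Rintegral_le _ _ R P (fun w => h (Zn n w)) (fun w => hc (Yp n w))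
    (fun w => cutoff k.+1 (B k) (Yp n w)) (large_noise m xi Y X k.+1 n) M eps
    (measurableT_comp mh (mZn n n0)) (measurableT_comp mhc (mYp n))
    (measurableT_comp (mcut k) (mYp n)) (measurable_large_noise m XGW k.+1 n0)
    M_ge0 (fun w => hM _) (fun w => hM _) _ _ (ltW eps0).
  apply: le_trans (bound _ _) _.
  - by move=> w; rewrite cutoff_ge0 cutoff_le1.
  (* Off the large noise, either the gap is at most [eps], or [Yp n w] is a bad path, witnessed by
     the actual immigration and noise; the cutoff is then [1] and the crude bound [2 * M]
     suffices. *)
  - move=> w wA; have [hle|hgt] := lerP `|h (Zn n w) - hc (Yp n w)| eps.
      by rewrite (le_trans hle)// lerDl !mulr_ge0// cutoff_ge0.
    rewrite cutoff_eq1; last first.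
      exists n, (fun i => (m n)^-1 * (Y n i w)%:R),
        (fun i => (m n)^-1 * GW_noise (Y n) (X n) (offspring_mean xi n) i w).
      split => // [i ink|].
        rewrite normrM gtr0_norm ?invr_gt0// mulrC ler_pdivrMr// mulrC.
        rewrite leNgt; apply/negP => noise_i; apply: wA.
        by exists i.
      move: hgt; rewrite /hc /= ZnE; congr (_ < `|h (step_path n _) - _|).
      by apply/funext => i; rewrite (scaled_GW_autoreg _ XGW)//.
    apply: (le_trans (ler_normB _ _)); apply: (@le_trans _ _ (M + M)).
      by rewrite lerD// hM.
    by rewrite mulr1 mulr_natl mulr2n lerDr ltW.
  have h2 : 2 * M * \int[P]_w cutoff k.+1 (B k) (Yp n w) <= 2 * M * (2 * x).
    by rewrite ler_wpM2l// mulr_ge0.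
  have h3 : 2 * M * fine (P (large_noise m xi Y X k.+1 n)) <= 2 * M * x.
    by rewrite ler_wpM2l// mulr_ge0.
  exact: arith.
have Zlim : \int[P]_w h (Zn n w) @[n --> \oo] --> \int[P]_w hc (Yl w).
  apply/cvgrPdist_le => e e0.
  have e2 : 0 < e / 2 by rewrite divr_gt0.
  have := main _ e2.
  move/cvgrPdist_le : (Ycvg hc M chc (fun x => hM _)) => /(_ _ e2).
  apply: filterS2 => n; rewrite !ler_norml => /andP[? ?] /andP[? ?].
  by apply/andP; split; lra.
rewrite (integral_pushforward_bounded (M := M) P mZ ch hM).
have -> : \int[P]_w h (Z w) = \int[P]_w hc (Yl w).
  by apply: eq_Rintegral => w _; rewrite ZE.
have : (\int[P]_w h (Zn n w))%:E @[n --> \oo] --> (\int[P]_w hc (Yl w))%:E.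
  by apply: cvg_EFin => //; exact: nearW.
apply: cvg_trans; apply: near_eq_cvg; exists 1%N => // n /= n0.
by rewrite (integral_pushforward_bounded (M := M) P (mZn n n0) ch hM).
Unshelve. all: by end_near. Qed.
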